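(* The hypergeometric functions $$\mathfrak f_1(z)=\sum_{n\ge0}\frac{(1/5)_n(4/5)_n}{n!^2}z^n\quad\text{and}\quad\mathfrak f_2(z)=\sum_{n\ge0}\frac{(1/3)_n(1/2)_n^2}{(2/3)_n\,n!^2}z^n$$ are algebraically independent over $\mathbb C(z)$.
   Context: $(x)_n$ denotes the Pochhammer symbol: $(x)_0=1$ and $(x)_n=x(x+1)\cdots(x+n-1)$ for $n\ge1$. *)

(* Defs.v *)
From HB Require Import structures.
From mathcomp Require Import all_boot all_order all_algebra.
From mathcomp Require Import boolp reals complex.
From mathcomp Require Import mpoly.

Set Implicit Arguments.
Unset Strict Implicit.
Unset Printing Implicit Defensive.

Import GRing.Theory.
Local Open Scope ring_scope.

(* The ring F[[z]]. It is a wrapper around nat -> F because the latter may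
   carry the pointwise product. *)
Record fps (F : fieldType) := Fps { fps_coef : nat -> F }.

Section PowerSeries.
Variable F : fieldType.
Implicit Types f g h : fps F.

Lemma fpsP f g : (forall n, fps_coef f n = fps_coef g n) <-> f = g.
Proof.
split=> [|->//]; case: f g => [u] [v] /= E; congr Fps; exact/funext.
Qed.

HB.instance Definition _ := gen_eqMixin (fps F).
HB.instance Definition _ := gen_choiceMixin (fps F).

Definition fps_zero : fps F := Fps (fun=> 0).
Definition fps_opp f : fps F := Fps (fun n => - fps_coef f n).
Definition fps_add f g : fps F := Fps (fun n => fps_coef f n + fps_coef g n).
Definition fps_one : fps F := Fps (fun n => (n == 0%N)%:R).
Definition fps_mul f g : fps F :=
  Fps (fun n => \sum_(i < n.+1) fps_coef f i * fps_coef g (n - i)).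

Fact fps_addA : associative fps_add.
Proof. by move=> f g h; apply/fpsP=> n /=; rewrite addrA. Qed.
Fact fps_addC : commutative fps_add.
Proof. by move=> f g; apply/fpsP=> n /=; rewrite addrC. Qed.
Fact fps_add0 : left_id fps_zero fps_add.
Proof. by move=> f; apply/fpsP=> n /=; rewrite add0r. Qed.
Fact fps_addN : left_inverse fps_zero fps_opp fps_add.
Proof. by move=> f; apply/fpsP=> n /=; rewrite addNr. Qed.

HB.instance Definition _ :=
  GRing.isZmodule.Build (fps F) fps_addA fps_addC fps_add0 fps_addN.

Definition fps_trunc m f : {poly F} := \poly_(i < m) fps_coef f i.

Lemma coef_fps_trunc m f n :
  (n < m)%N -> (fps_trunc m f)`_n = fps_coef f n.
Proof. by move=> lt_nm; rewrite coef_poly lt_nm. Qed.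

Lemma fps_mul_trunc m f g n : (n < m)%N ->
  fps_coef (fps_mul f g) n = (fps_trunc m f * fps_trunc m g)`_n.
Proof.
move=> lt_nm; rewrite coefM /=; apply: eq_bigr => i _.
have le_in : (i <= n)%N by rewrite -ltnS.
by rewrite !coef_fps_trunc // ?(leq_ltn_trans (leq_subr _ _)) //
           (leq_ltn_trans le_in).
Qed.

Fact fps_mulC : commutative fps_mul.
Proof.
by move=> f g; apply/fpsP=> n; rewrite !(@fps_mul_trunc n.+1) // mulrC.
Qed.

Fact fps_mulA : associative fps_mul.
Proof.
move=> f g h; apply/fpsP=> n.
pose t := fps_trunc n.+1.
transitivity ((t f * t g * t h)`_n).
  rewrite -mulrA coefM; apply: eq_bigr => i _.
  by rewrite coef_fps_trunc // -fps_mul_trunc // ltnS leq_subr.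
rewrite coefM; apply: eq_bigr => i _.
by rewrite coef_fps_trunc ?ltnS ?leq_subr // -fps_mul_trunc.
Qed.

Fact fps_mul1 : left_id fps_one fps_mul.
Proof.
move=> f; apply/fpsP=> n /=.
rewrite big_ord_recl /= mul1r subn0 big1 ?addr0 // => i _.
by rewrite mul0r.
Qed.

Fact fps_mulDl : left_distributive fps_mul fps_add.
Proof.
move=> f g h; apply/fpsP=> n /=; rewrite -big_split /=.
by apply: eq_bigr => i _; rewrite mulrDl.
Qed.

Fact fps_one_neq0 : fps_one != fps_zero.
Proof.
by apply/eqP => /fpsP /(_ 0%N) /= /eqP; rewrite oner_eq0.
Qed.

HB.instance Definition _ := GRing.Zmodule_isComNzRing.Build (fps F)
  fps_mulA fps_mulC fps_mul1 fps_mulDl fps_one_neq0.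

Lemma fps_coef0 n : fps_coef (0 : fps F) n = 0. Proof. by []. Qed.
Lemma fps_coef1 n : fps_coef (1 : fps F) n = (n == 0%N)%:R. Proof. by []. Qed.
Lemma fps_coefN f n : fps_coef (- f) n = - fps_coef f n. Proof. by []. Qed.
Lemma fps_coefD f g n : fps_coef (f + g) n = fps_coef f n + fps_coef g n.
Proof. by []. Qed.
Lemma fps_coefM f g n :
  fps_coef (f * g) n = \sum_(i < n.+1) fps_coef f i * fps_coef g (n - i).
Proof. by []. Qed.

Definition fps_unit : pred (fps F) := fun f => `[< exists g, g * f = 1 >].
Definition fps_inv f : fps F :=
  if pselect (exists g, g * f = 1) is left ex then projT1 (cid ex) else f.

Fact fps_mulVf : {in fps_unit, left_inverse 1 fps_inv *%R}.
Proof.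
move=> f; rewrite /fps_inv => /asboolP Uf.
by case: pselect => // ex; case: cid.
Qed.
Fact fps_unitP f g : g * f = 1 -> fps_unit f.
Proof. by move=> gf1; apply/asboolP; exists g. Qed.
Fact fps_inv_out : {in [predC fps_unit], fps_inv =1 id}.
Proof.
by move=> f /asboolP nUf; rewrite /fps_inv; case: pselect.
Qed.

HB.instance Definition _ := GRing.ComNzRing_hasMulInverse.Build (fps F)
  fps_mulVf fps_unitP fps_inv_out.

Lemma fps_neq0P f : f != 0 -> exists i, fps_coef f i != 0.
Proof.
move=> f_neq0; apply/not_existsP => f0; case/eqP: f_neq0.
by apply/fpsP => i; apply/eqP; apply: contrapT => /negP /f0.
Qed.

Fact fps_idomain f g : f * g = 0 -> (f == 0) || (g == 0).
Proof.
move=> fg0; apply: contraPT fg0; rewrite negb_or => /andP[].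
move=> /fps_neq0P exf /fps_neq0P exg.
case: (ex_minnP exf) => i fi_neq0 min_i.
case: (ex_minnP exg) => j gj_neq0 min_j.
move=> /fpsP /(_ (i + j)%N) /eqP; apply/negP; rewrite fps_coefM.
have lt_i : (i < (i + j).+1)%N by rewrite ltnS leq_addr.
rewrite (bigD1 (Ordinal lt_i)) //= addKn big1 ?addr0 ?mulf_neq0 //.
move=> k; rewrite -val_eqE /= neq_ltn => /orP[lt_ki|lt_ik].
  have [->|/min_i] := eqVneq (fps_coef f k) 0; first by rewrite mul0r.
  by rewrite leqNgt lt_ki.
have [->|/min_j] := eqVneq (fps_coef g (i + j - k)) 0; first by rewrite mulr0.
have le_k : (k <= i + j)%N by rewrite -ltnS.
by rewrite leqNgt ltn_subLR // ltn_add2r lt_ik.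
Qed.

HB.instance Definition _ :=
  GRing.ComUnitRing_isIntegral.Build (fps F) fps_idomain.

Definition fps_of_poly (p : {poly F}) : fps F := Fps (fun n => p`_n).

Fact fps_of_poly_is_zmod_morphism : zmod_morphism fps_of_poly.
Proof. by move=> p q; apply/fpsP => n /=; rewrite coefB. Qed.
HB.instance Definition _ := GRing.isZmodMorphism.Build {poly F} (fps F)
  fps_of_poly fps_of_poly_is_zmod_morphism.

Fact fps_of_poly_is_monoid_morphism : monoid_morphism fps_of_poly.
Proof.
by split=> [|p q]; apply/fpsP => n /=; rewrite ?coef1 ?coefM.
Qed.
HB.instance Definition _ := GRing.isMonoidMorphism.Build {poly F} (fps F)
  fps_of_poly fps_of_poly_is_monoid_morphism.

Lemma fps_of_poly_inj : injective fps_of_poly.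
Proof. by move=> p q /fpsP E; apply/polyP. Qed.

End PowerSeries.

(* F((z)), as Frac F[[z]], and the inclusion of F(z) = Frac F[z] in it. *)
Notation laurent F := {fraction (fps F)}.

Definition laurent_of_fps (F : fieldType) (f : fps F) : laurent F :=
  FracField.tofrac f.

Definition laurent_of_ratfun (F : fieldType) (r : {fraction {poly F}}) :
    laurent F :=
  laurent_of_fps (fps_of_poly \n_(repr r)) /
  laurent_of_fps (fps_of_poly \d_(repr r)).

Section RationalFunctions.
Variable F : fieldType.
Local Notation iota := (@laurent_of_ratfun F).
Local Notation toL p := (laurent_of_fps (fps_of_poly p)).
Local Notation "p %:F" := (FracField.tofrac p).

Lemma toL_eq0 (p : {poly F}) : (toL p == 0) = (p == 0).
Proof.
rewrite /laurent_of_fps tofrac_eq0 -(inj_eq (@fps_of_poly_inj F)).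
by rewrite raddf0.
Qed.

Lemma ratfun_numden (r : {fraction {poly F}}) :
  r = (\n_(repr r))%:F / (\d_(repr r))%:F.
Proof.
have d0 : (\d_(repr r))%:F != 0 by rewrite tofrac_eq0 denom_ratioP.
apply: (mulIf d0); rewrite divfK // -{1}[r]reprK.
unlock FracField.tofrac.
rewrite -[LHS]FracField.pi_mul; apply/eqmodP.
rewrite /= FracField.equivfE /FracField.mulf.
by rewrite !numden_Ratio ?mulf_neq0 ?oner_eq0 ?denom_ratioP // !mulr1 mulrC.
Qed.

Lemma laurent_of_ratfunE (p q : {poly F}) : q != 0 ->
  iota (p%:F / q%:F) = toL p / toL q.
Proof.
move=> q0; set r := p%:F / q%:F.
have d0 : \d_(repr r) != 0 by exact: denom_ratioP.
have : p * \d_(repr r) = \n_(repr r) * q.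
  apply/eqP; rewrite -tofrac_eq !tofracM -eqr_div ?tofrac_eq0 //.
  by rewrite -ratfun_numden.
move=> /(congr1 (fun p => toL p)); rewrite /laurent_of_fps !rmorphM /= => E.
by apply/eqP; rewrite eqr_div ?toL_eq0 // -E mulrC.
Qed.

Fact laurent_of_ratfun_is_zmod_morphism : zmod_morphism iota.
Proof.
move=> r s; rewrite [r]ratfun_numden [s]ratfun_numden.
set a := \n_(repr r); set b := \d_(repr r).
set c := \n_(repr s); set d := \d_(repr s).
have b0 : b != 0 by exact: denom_ratioP.
have d0 : d != 0 by exact: denom_ratioP.
rewrite -mulNr -rmorphN addf_div ?tofrac_eq0 // -!rmorphM -rmorphD.
rewrite !laurent_of_ratfunE ?mulf_neq0 //.
rewrite /laurent_of_fps !rmorphD !rmorphM !rmorphN /=.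
by rewrite -[X in _ = _ + X]mulNr addf_div ?toL_eq0.
Qed.
HB.instance Definition _ := GRing.isZmodMorphism.Build _ _ iota
  laurent_of_ratfun_is_zmod_morphism.

Fact laurent_of_ratfun_is_monoid_morphism : monoid_morphism iota.
Proof.
split=> [|r s].
  rewrite -[X in iota X](divr1 1) -tofrac1.
  by rewrite laurent_of_ratfunE ?oner_eq0 // divff // toL_eq0 oner_eq0.
rewrite [r]ratfun_numden [s]ratfun_numden.
have r0 : \d_(repr r) != 0 by exact: denom_ratioP.
have s0 : \d_(repr s) != 0 by exact: denom_ratioP.
rewrite mulf_div -!rmorphM !laurent_of_ratfunE ?mulf_neq0 //.
by rewrite /laurent_of_fps !rmorphM /= mulf_div.
Qed.
HB.instance Definition _ := GRing.isMonoidMorphism.Build _ _ iota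
  laurent_of_ratfun_is_monoid_morphism.

End RationalFunctions.

Definition algebraically_independent (K L : fieldType) (iota : {rmorphism K -> L})
    (n : nat) (x : 'I_n -> L) : Prop :=
  forall P : {mpoly K[n]}, (map_mpoly iota P).@[x] = 0 -> P = 0.

Definition pochhammer (F : fieldType) (x : F) (n : nat) : F :=
  \prod_(i < n) (x + i%:R).

Definition hyper_f1 (F : fieldType) : fps F := Fps (fun n =>
  pochhammer (1 / 5%:R) n * pochhammer (4%:R / 5%:R) n / n`!%:R ^+ 2).

Definition hyper_f2 (F : fieldType) : fps F := Fps (fun n =>
  pochhammer (1 / 3%:R) n * pochhammer (1 / 2%:R) n ^+ 2
    / (pochhammer (2%:R / 3%:R) n * n`!%:R ^+ 2)).

(* Main.v *)
Require Import Defs.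
From mathcomp Require Import all_boot all_order all_algebra all_field.
From mathcomp Require Import boolp reals complex mpoly ring zify.

Set Implicit Arguments.
Unset Strict Implicit.
Unset Printing Implicit Defensive.
Import Order.TTheory GRing.Theory Num.Theory.
Local Open Scope ring_scope.

(* Let p = 30 t + 1 be a large prime. Modulo p both series satisfy a congruence
   of Lucas type, which says that f_i = A_i f_i ^ p over F_p, where A_i is the
   truncation of f_i at order p. An algebraic relation over C(z) is a linear
   relation between power series with p-integral rational coefficients, so it
   gives a nontrivial relation of the same degree over F_p(z). Comparing a
   relation of minimal length with its image under Frobenius yields
   A_1 ^ i A_2 ^ j = c ^ (p - 1) in F_p(z), with (i, j) <> (0, 0) small compared
   to p. By the differential equations satisfied by the A_i, their roots other
   than 0 and 1 have multiplicity at most 1 (resp. 2), hence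
   A_2 = A_1 ^ m (1 - z) ^ e with m = 1 or 2; the coefficient of z rules this
   out. *)

(** * Primes congruent to 1 modulo 30 *)

Lemma Fp_nat_eq0 p n : prime p -> (n%:R == 0 :> 'F_p) = (p %| n)%N.
Proof. by move=> p_pr; rewrite -(dvdn_pcharf (pchar_Fp p_pr)). Qed.

Lemma Fp_exp_pred p (x : 'F_p) : prime p -> x != 0 -> x ^+ p.-1 = 1.
Proof.
move=> p_pr x0; apply: (mulfI x0); rewrite mulr1 -exprS prednK ?prime_gt0 //.
by have := expf_card x; rewrite card_Fp.
Qed.

(* The left-hand side of the equation is the value at x of the 30th cyclotomic
   polynomial. *)
Lemma root_cyclotomic30_dvd (p : nat) (x : 'F_p) : prime p -> coprime p 30 ->
  x ^+ 8 + x ^+ 7 - x ^+ 5 - x ^+ 4 - x ^+ 3 + x + 1 = 0 -> (30 %| p.-1)%N.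
Proof.
move=> p_pr p30 x0.
have pN q : prime q -> (q %| 30)%N -> q%:R != 0 :> 'F_p.
  move=> q_pr q30; rewrite Fp_nat_eq0 // dvdn_prime2 //.
  by apply: contraL p30 => /eqP->; rewrite prime_coprime // negbK.
(* The 30th cyclotomic polynomial divides X^15 + 1, X^10 - X^5 + 1 and X^12 - X^9 + X^6 - X^3 + 1,
   with the cofactors displayed. *)
have x15 : x ^+ 15 = -1.
  have -> : x ^+ 15 = (x ^+ 8 + x ^+ 7 - x ^+ 5 - x ^+ 4 - x ^+ 3 + x + 1) *
    (x ^+ 7 - x ^+ 6 + x ^+ 5 + x ^+ 2 - x + 1) - 1 by ring.
  by rewrite x0 mul0r sub0r.
have x10 : x ^+ 10 - x ^+ 5 + 1 = 0.
  have -> : x ^+ 10 - x ^+ 5 + 1 = (x ^+ 8 + x ^+ 7 - x ^+ 5 - x ^+ 4 -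
    x ^+ 3 + x + 1) * (x ^+ 2 - x + 1) by ring.
  by rewrite x0 mul0r.
have x12 : x ^+ 12 - x ^+ 9 + x ^+ 6 - x ^+ 3 + 1 = 0.
  have -> : x ^+ 12 - x ^+ 9 + x ^+ 6 - x ^+ 3 + 1 = (x ^+ 8 + x ^+ 7 -
    x ^+ 5 - x ^+ 4 - x ^+ 3 + x + 1) * (x ^+ 4 - x ^+ 3 + x ^+ 2 - x + 1).
    by ring.
  by rewrite x0 mul0r.
have x_neq0 : x != 0.
  by apply: contra_eqN x15 => /eqP->; rewrite expr0n /= eq_sym oppr_eq0 oner_eq0.
have x30 : x ^+ 30 = 1 by rewrite (exprM x 15 2) x15 sqrrN expr1n.
have [m xm m30] := @prim_order_exists _ 30 x isT x30.
suff <- : m = 30%N by rewrite (prim_order_dvd xm) Fp_exp_pred.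
(* A proper divisor of 30 divides 6, 10 or 15, and x^6 = 1, x^10 = 1 or x^15 = 1 would make 5, 3 or
   2 vanish in F_p. *)
have x6N : x ^+ 6 != 1.
  apply: contraNneq (pN 5 isT isT) => x6.
  have x3 : x ^+ 3 = -1.
    by rewrite -x15 (exprD x 12 3) (exprM x 6 2) x6 expr1n mul1r.
  by rewrite -x12 (exprM x 6 2) (exprD x 6 3) x6 x3; apply/eqP; ring.
have x10N : x ^+ 10 != 1.
  apply: contraNneq (pN 3 isT isT) => x10_1.
  have x5 : x ^+ 5 = -1 by rewrite -x15 (exprD x 10 5) x10_1 mul1r.
  by rewrite -x10 x10_1 x5; apply/eqP; ring.
have x15N : x ^+ 15 != 1.
  apply: contraNneq (pN 2 isT isT); rewrite x15 => N1.
  by rewrite mulr2n -[X in X + _]N1 addNr.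
have : m \in divisors 30 by rewrite -dvdn_divisors.
rewrite -(prim_order_dvd xm) in x6N; rewrite -(prim_order_dvd xm) in x10N.
rewrite -(prim_order_dvd xm) in x15N; rewrite !inE.
by do !case/orP; move/eqP=> mE; move: x6N x10N x15N; rewrite mE.
Qed.

(** Euclid's argument: a prime divisor of the 30th cyclotomic polynomial at x = 30 M! is prime to x,
    hence larger than M and prime to 30. *)
Lemma prime_1mod30 (M : nat) :
  exists2 p, prime p & (M < p)%N /\ exists t, p = (30 * t).+1.
Proof.
pose x := (30 * M`!)%N.
have x_gt0 : (29 < x)%N by rewrite -[30%N]muln1 leq_mul // fact_gt0.
(* Chosen so that [x * y + 1] is the cyclotomic value; by [ltx] the subtraction is not truncated. *)
pose y := (x ^ 7 + x ^ 6 + 1 - (x ^ 4 + x ^ 3 + x ^ 2))%N.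
have ltx : (x ^ 4 + x ^ 3 + x ^ 2 <= x ^ 7)%N.
  apply: (@leq_trans (x ^ 4 * 3)); last first.
    rewrite (expnD x 4 3) leq_mul2l; apply/orP; right.
    by apply: leq_trans (_ : x ^ 1 <= _)%N; rewrite ?leq_pexp2l //; lia.
  have : (x ^ 3 <= x ^ 4)%N by rewrite leq_pexp2l //; lia.
  have : (x ^ 2 <= x ^ 4)%N by rewrite leq_pexp2l //; lia.
  lia.
pose N := (x * y + 1)%N.
have y_gt0 : (0 < y)%N by rewrite /y; lia.
have N_gt1 : (1 < N)%N by rewrite /N; nia.
have p_pr := pdiv_prime N_gt1; have pN := pdiv_dvd N; set p := pdiv N in p_pr pN.
have px : coprime p x.
  rewrite prime_coprime //; apply: contraL pN => px.
  rewrite /N dvdn_addr; last exact: dvdn_mulr.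
  by rewrite dvdn1 neq_ltn prime_gt1 ?orbT.
have p30 : coprime p 30 by move: px; rewrite /x coprimeMr => /andP[].
exists p => //; split.
  rewrite ltnNge; apply: contraL px => pM.
  by rewrite prime_coprime // negbK dvdn_mull // dvdn_fact // prime_gt0.
suff /dvdnP[t tE] : (30 %| p.-1)%N.
  by exists t; rewrite mulnC -tE prednK ?prime_gt0.
clearbody x; apply: (@root_cyclotomic30_dvd p x%:R) => //.
move: pN; rewrite -Fp_nat_eq0 // => /eqP <-.
rewrite /N natrD natrM /y natrB; last by lia.
by rewrite !natrD !natrX; ring.
Qed.

(** * Reduction modulo p of p-integral rational numbers *)

Section Reduction.
Variables (F : numFieldType) (p : nat).
Implicit Types (x : F) (y : 'F_p).

(** The graph of reduction modulo p on the p-integral rationals inside [F]. A relation avoids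
    choosing a fraction; [reduces_fun] makes it single-valued. *)
Definition reduces x y := exists n d : int,
  [/\ d%:~R != 0 :> 'F_p, x = n%:~R / d%:~R & y = n%:~R / d%:~R].

Lemma intr_Fp_neq0 (d : int) : d%:~R != 0 :> 'F_p -> d%:~R != 0 :> F.
Proof. by apply: contraNneq => /eqP; rewrite intr_eq0 => /eqP->. Qed.

Lemma reduces_int (n : int) : reduces n%:~R n%:~R.
Proof. by exists n, 1; rewrite oner_neq0 !divr1. Qed.

Lemma reduces_nat (n : nat) : reduces n%:R n%:R.
Proof. exact: (reduces_int n). Qed.

Lemma reduces0 : reduces 0 0. Proof. exact: (reduces_nat 0). Qed.

Lemma reduces1 : reduces 1 1. Proof. exact: (reduces_nat 1). Qed.

Lemma reducesD x1 y1 x2 y2 :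
  reduces x1 y1 -> reduces x2 y2 -> reduces (x1 + x2) (y1 + y2).
Proof.
move=> [n1 [d1 [d1N0 -> ->]]] [n2 [d2 [d2N0 -> ->]]].
exists (n1 * d2 + n2 * d1), (d1 * d2).
by rewrite !rmorphD !rmorphM /= mulf_neq0 // !addf_div ?intr_Fp_neq0.
Qed.

Lemma reducesM x1 y1 x2 y2 :
  reduces x1 y1 -> reduces x2 y2 -> reduces (x1 * x2) (y1 * y2).
Proof.
move=> [n1 [d1 [d1N0 -> ->]]] [n2 [d2 [d2N0 -> ->]]].
exists (n1 * n2), (d1 * d2).
by rewrite !rmorphM /= mulf_neq0 // !mulf_div.
Qed.

Lemma reducesX x y n : reduces x y -> reduces (x ^+ n) (y ^+ n).
Proof.
by move=> xy; elim: n => [|n IHn]; [exact: reduces1 | rewrite !exprS; exact: reducesM].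
Qed.

Lemma reducesV x y : y != 0 -> reduces x y -> reduces x^-1 y^-1.
Proof.
move=> y0 [n [d [d0 -> yE]]]; exists d, n; split; last by rewrite yE invf_div.
  by move: y0; rewrite yE mulf_eq0 negb_or => /andP[].
by rewrite invf_div.
Qed.

Lemma reduces_sum (I : Type) (r : seq I) (P : pred I) (f : I -> F) (g : I -> 'F_p) :
  (forall i, P i -> reduces (f i) (g i)) ->
  reduces (\sum_(i <- r | P i) f i) (\sum_(i <- r | P i) g i).
Proof. by move=> fg; apply: big_ind2 => //; [exact: reduces0 | exact: reducesD]. Qed.

Lemma reduces_prod (I : Type) (r : seq I) (P : pred I) (f : I -> F) (g : I -> 'F_p) :
  (forall i, P i -> reduces (f i) (g i)) ->
  reduces (\prod_(i <- r | P i) f i) (\prod_(i <- r | P i) g i).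
Proof. by move=> fg; apply: big_ind2 => //; [exact: reduces1 | exact: reducesM]. Qed.

Lemma reduces_det n (A : 'M[F]_n) (B : 'M['F_p]_n) :
  (forall i j, reduces (A i j) (B i j)) -> reduces (\det A) (\det B).
Proof.
move=> AB; apply: reduces_sum => s _; apply: reducesM; last exact: reduces_prod.
by rewrite -[X in reduces X](rmorph_sign intr) -[X in reduces _ X](rmorph_sign intr);
  exact: reduces_int.
Qed.

Lemma reduces_fun x y1 y2 : reduces x y1 -> reduces x y2 -> y1 = y2.
Proof.
move=> [n1 [d1 [d1N0 -> ->]]] [n2 [d2 [d2N0 /eqP + ->]]].
rewrite eqr_div ?intr_Fp_neq0 // -!intrM eqr_int => /eqP E.
by apply/eqP; rewrite eqr_div // -!intrM E.
Qed.

(* The first columns on which no nonzero vector of the finite space F_p^T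
   vanishes have full rank, hence a nonzero minor; it lifts to F. *)
Lemma reduces_dependent (T : finType) (w : T -> nat -> F) (v : T -> nat -> 'F_p) :
  prime p -> (forall t n, reduces (w t n) (v t n)) ->
  (exists2 c : T -> F, exists t, c t != 0 & forall n, \sum_t c t * w t n = 0) ->
  exists2 c : {ffun T -> 'F_p}, c != 0 & forall n, \sum_t c t * v t n = 0.
Proof.
move=> p_pr wv [c [t0 ct0] cw]; apply: contrapT => noc.
have bad (e : {ffun T -> 'F_p}) : exists n, e != 0 -> \sum_t e t * v t n != 0.
  have [->|e0] := eqVneq e 0; first by exists 0%N.
  apply: contrapT => nex; apply: noc; exists e => // n.
  by apply: contrapT => /eqP en; apply: nex; exists n.
have [f fP] := choice bad.
pose N := (\max_e f e).+1.
pose V := (\matrix_(n < N, i < #|T|) v (enum_val i) n).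
have sumT (K : nmodType) (g : T -> K) : \sum_t g t = \sum_(i < #|T|) g (enum_val i).
  by rewrite (reindex (@enum_val _ T)) //; exact: (onW_bij _ (enum_val_bij _)).
have rfull : row_full V.
  rewrite /row_full -mxrank_tr -[_ == _]/(row_free _) -kermx_eq0.
  rewrite -submx0; apply/rV_subP => x /sub_kermxP xV.
  rewrite submx0; pose e := [ffun t => x 0 (enum_rank t)].
  have eN : (f e < N)%N by rewrite ltnS (leq_bigmax (F := f)).
  have [e0|/fP/eqP[]] := eqVneq e 0.
    apply/eqP/rowP => i; move/ffunP/(_ (enum_val i)): e0.
    by rewrite !ffunE enum_valK !mxE.
  move/rowP/(_ (Ordinal eN)): xV; rewrite !mxE => xV0.
  by rewrite -[RHS]xV0 sumT; apply: eq_bigr => i _; rewrite !mxE ffunE enum_valK.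
pose g := fullrankfun rfull.
have : rowsub g V \in unitmx by exact: fullrowsub_unit.
rewrite unitmxE unitfE; apply/negP; rewrite negbK.
(* [W] lifts the invertible matrix [rowsub g V], but the relation [c] over [F] is a nonzero kernel
   vector of it. *)
pose W := \matrix_(k < #|T|, i < #|T|) w (enum_val i) (g k).
suff detW : \det W = 0.
  apply/eqP/(@reduces_fun 0 _ _ _ reduces0).
  by rewrite -detW; apply: reduces_det => i j; rewrite !mxE.
apply/eqP; rewrite -det_tr; apply/det0P.
exists (\row_i c (enum_val i)).
  apply: contraNneq ct0 => /rowP/(_ (enum_rank t0)).
  by rewrite !mxE enum_rankK => ->.
apply/rowP => k; rewrite !mxE -[RHS](cw (g k)) sumT.
by apply: eq_bigr => i _; rewrite !mxE.
Qed.

Definition fps_reduces (f : fps F) (g : fps 'F_p) :=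
  forall n, reduces (fps_coef f n) (fps_coef g n).

Lemma fps_reducesM f1 g1 f2 g2 :
  fps_reduces f1 g1 -> fps_reduces f2 g2 -> fps_reduces (f1 * f2) (g1 * g2).
Proof.
move=> h1 h2 n; rewrite !fps_coefM; apply: reduces_sum => i _.
exact: reducesM.
Qed.

Lemma fps_reducesX f g n : fps_reduces f g -> fps_reduces (f ^+ n) (g ^+ n).
Proof.
move=> fg; elim: n => [|n IHn]; last by rewrite !exprS; exact: fps_reducesM.
by move=> n; rewrite !fps_coef1; exact: reduces_nat.
Qed.

Lemma fps_reduces_Xn n : fps_reduces (fps_of_poly 'X^n) (fps_of_poly 'X^n).
Proof. by move=> k /=; rewrite !coefXn; exact: reduces_nat. Qed.

End Reduction.

(** * Congruences of Lucas type *)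

Lemma pochhammer0 (F : fieldType) (a : F) : pochhammer a 0 = 1.
Proof. exact: big_ord0. Qed.

Lemma pochhammerS (F : fieldType) (a : F) n :
  pochhammer a n.+1 = pochhammer a n * (a + n%:R).
Proof. exact: big_ord_recr. Qed.

Lemma pochhammer_addb (F : fieldType) (a : F) n (b : bool) :
  pochhammer a (n + b) = pochhammer a n * (a + n%:R) ^+ b.
Proof. by case: b; rewrite ?addn1 ?pochhammerS // addn0 mulr1. Qed.

Lemma pochhammer1 (F : fieldType) n : pochhammer (1 : F) n = n`!%:R.
Proof.
elim: n => [|n IHn]; first by rewrite pochhammer0.
by rewrite pochhammerS IHn factS natrM mulrC -natr1 addrC.
Qed.

Lemma hyper_f1_coef0 (F : fieldType) : fps_coef (hyper_f1 F) 0 = 1.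
Proof. by rewrite /= !pochhammer0 fact0 !expr1n !mul1r invr1. Qed.

Lemma hyper_f2_coef0 (F : fieldType) : fps_coef (hyper_f2 F) 0 = 1.
Proof. by rewrite /= !pochhammer0 fact0 !expr1n !mul1r invr1. Qed.

Lemma pochhammer_gt0 (F : numFieldType) (a : F) n : 0 < a -> 0 < pochhammer a n.
Proof. by move=> a0; apply: prodr_gt0 => i _; rewrite ltr_wpDr ?ler0n. Qed.

Section Pochhammer.
Variables (F : numFieldType) (p : nat).
Hypothesis p_pr : prime p.

(* [a + k = p * a] says that a is its own Dwork prime: among the p consecutive
   factors a + (p q + i), i < p, only i = k is divisible by p, and it is
   p (a + q). *)
Variables (a : F) (b : 'F_p) (k : nat).
Hypotheses (k_lt : (k < p)%N) (ak : a + k%:R = p%:R * a).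
Hypotheses (ab : reduces a b) (bk : b + k%:R = 0).

(** Below p the omitted factor is the only one that vanishes in F_p, so this is the unit part of the
    Pochhammer symbol. *)
Definition unit_pochhammer m : 'F_p := \prod_(i < m | i != k :> nat) (b + i%:R).

Lemma unit_pochhammerS m :
  unit_pochhammer m.+1 = unit_pochhammer m * (if k == m then 1 else b + m%:R).
Proof.
by rewrite /unit_pochhammer big_mkcond big_ord_recr -big_mkcond eq_sym if_neg.
Qed.

Lemma Fp_shift_eq0 i : (i < p)%N -> (b + i%:R == 0) = (i == k).
Proof.
move=> ip; have -> : b = - k%:R by apply/eqP; rewrite -addr_eq0 bk.
rewrite addrC subr_eq0; apply/eqP/eqP => [/(congr1 val)|->//].
by rewrite /= !val_Fp_nat // !modn_small.
Qed.

Lemma unit_pochhammer_neq0 m : (m <= p)%N -> unit_pochhammer m != 0.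
Proof.
move=> mp; apply/prodf_neq0 => i ik; rewrite Fp_shift_eq0 //.
exact: leq_trans mp.
Qed.

Lemma pochhammer_unit m :
  pochhammer b m = if (k < m)%N then 0 else unit_pochhammer m.
Proof.
case: ltnP => km.
  by rewrite /pochhammer (bigD1 (Ordinal km)) //= bk mul0r.
by apply: eq_bigl => i; rewrite neq_ltn (leq_trans (ltn_ord i) km).
Qed.

(** Over p consecutive indices, b + i runs through all of F_p, and the omitted value is 0. *)
Lemma unit_pochhammer_full : unit_pochhammer p = \prod_(x : 'F_p | x != 0) x.
Proof.
rewrite [RHS](reindex_inj (addrI b)) /=.
pose G n : 'F_p := if b + n%:R != 0 then b + n%:R else 1.
transitivity (\prod_(i < p) G i).
  rewrite /unit_pochhammer big_mkcond; apply: eq_bigr => i _.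
  by rewrite /G Fp_shift_eq0.
rewrite [RHS]big_mkcond.
have cast n : n = p -> \prod_(i < p) G i = \prod_(i < n) G i by move->.
by rewrite (cast _ (Fp_cast p_pr)); apply: eq_bigr => i _; rewrite /G natr_Zp.
Qed.

(** The new factor is a + (p q + m). For m = k it equals p (a + q), which provides one power of p
    and the next factor of the Pochhammer symbol of a; otherwise it reduces to b + m and joins the
    unit [u]. *)
Lemma pochhammer_block_step q m w : (m < p)%N ->
  (exists2 u : F,
    pochhammer a (p * q + m) =
      p%:R ^+ (q + (k < m)) * pochhammer a (q + (k < m)) * u &
    reduces u (w * unit_pochhammer m)) ->
  exists2 u : F,
    pochhammer a (p * q + m.+1) =
      p%:R ^+ (q + (k < m.+1)) * pochhammer a (q + (k < m.+1)) * u &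
    reduces u (w * unit_pochhammer m.+1).
Proof.
have pF : p%:R = 0 :> 'F_p by apply/eqP; rewrite Fp_nat_eq0.
move=> mp [u uE ur]; rewrite addnS pochhammerS uE ltnS unit_pochhammerS.
case: (ltngtP k m) => [km|km|km]; last first.
- exists u; rewrite ?mulr1 // -km addn0 addn1 pochhammerS exprSr.
  have -> : a + (p * q + k)%:R = p%:R * (a + q%:R).
    by rewrite mulrDr -ak natrD natrM; ring.
  by ring.
all: exists (u * (a + (p * q + m)%:R)); first by rewrite mulrA.
all: rewrite mulrA; apply: reducesM => //; apply: reducesD => //.
all: have -> : m%:R = (p * q + m)%:R :> 'F_p by rewrite natrD natrM pF mul0r add0r.
all: exact: reduces_nat.
Qed.

(** Each full block of p factors leaves one p (a + j) and the product of the nonzero residues.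
    Induction on q, then on m: block q + 1 starts where block q ends, at m = p. *)
Lemma pochhammer_block q m : (m <= p)%N ->
  exists2 u : F,
    pochhammer a (p * q + m) =
      p%:R ^+ (q + (k < m)) * pochhammer a (q + (k < m)) * u &
    reduces u ((\prod_(x : 'F_p | x != 0) x) ^+ q * unit_pochhammer m).
Proof.
have pF : p%:R = 0 :> 'F_p by apply/eqP; rewrite Fp_nat_eq0.
elim: q m => [|q IHq] m; elim: m => [_|m IHm mp].
- exists 1; first by rewrite muln0 ltn0 !pochhammer0 !mulr1.
  by rewrite /unit_pochhammer big_ord0 mulr1; exact: reduces1.
- exact: pochhammer_block_step (IHm (ltnW mp)).
- have [u uE ur] := IHq p (leqnn p); exists u.
    by rewrite addn0 mulnS addnC uE k_lt ltn0 (addn1 q) (addn0 q.+1).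
  by rewrite /unit_pochhammer big_ord0 mulr1 exprSr -[X in _ * X]unit_pochhammer_full.
- exact: pochhammer_block_step (IHm (ltnW mp)).
Qed.

End Pochhammer.

(** Both series have as many Pochhammer factors above as below, so the contribution [w] of the full
    blocks cancels. *)
Lemma cancel_f1 (K : fieldType) (w v1 v2 v3 : K) : w != 0 -> v3 != 0 ->
  w * v1 * (w * v2) / (w * v3) ^+ 2 = v1 * v2 / v3 ^+ 2.
Proof. by move=> w0 v30; field; rewrite v30 w0. Qed.

Lemma cancel_f2 (K : fieldType) (w v1 v2 v3 v4 : K) :
    w != 0 -> v3 != 0 -> v4 != 0 ->
  w * v1 * (w * v2) ^+ 2 / (w * v4 * (w * v3) ^+ 2) = v1 * v2 ^+ 2 / (v4 * v3 ^+ 2).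
Proof. by move=> w0 v30 v40; field; rewrite v30 v40 w0. Qed.

Section Lucas.
Variables (F : numFieldType) (p t : nat).
Hypotheses (p_pr : prime p) (pE : p = (30 * t).+1) (t_gt0 : (0 < t)%N).

Lemma pE_Fp : 30%:R * t%:R + 1 = 0 :> 'F_p.
Proof. by apply/eqP; rewrite -natrM natr1 Fp_nat_eq0 // -[X in (_ %| X)%N]pE. Qed.

Lemma natr_Fp_neq0 d : (0 < d < 31)%N -> d%:R != 0 :> 'F_p.
Proof. by move=> d31; rewrite Fp_nat_eq0 // gtnNdvd; lia. Qed.

Lemma reduces_frac (n d : nat) : d%:R != 0 :> 'F_p ->
  reduces (n%:R / d%:R : F) (n%:R / d%:R : 'F_p).
Proof.
by move=> d0; apply: reducesM; [|apply: reducesV => //]; exact: reduces_nat.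
Qed.

Lemma frac_shift_Fp (n d k : nat) : (0 < d < 31)%N -> (d * k = n * (30 * t))%N ->
  n%:R / d%:R + k%:R = 0 :> 'F_p.
Proof.
move=> /natr_Fp_neq0 dFp kE.
apply: (mulfI dFp); rewrite mulrDr mulr0 mulrCA divff // mulr1 -natrM kE.
by rewrite !natrM -[X in X + _]mulr1 -mulrDr addrC pE_Fp mulr0.
Qed.

Lemma pochhammer_Fp_eq0 (n d k m : nat) :
  (0 < d < 31)%N -> (0 < n <= d)%N -> (d * k = n * (30 * t))%N -> (m <= p)%N ->
  (pochhammer (n%:R / d%:R : 'F_p) m == 0) = (k < m)%N.
Proof.
move=> d31 nd kE mp; have bk := frac_shift_Fp d31 kE.
have k_lt : (k < p)%N by move: d31 nd kE; rewrite pE; clear; nia.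
rewrite (pochhammer_unit bk); case: ltnP => _; first exact: eqxx.
by apply/negbTE; exact: unit_pochhammer_neq0.
Qed.

(** With k = n (p - 1) / d one has n / d + k = p (n / d), so [pochhammer_block] applies to a = n /
    d. *)
Lemma pochhammer_block_frac (n d k q m : nat) :
  (0 < d < 31)%N -> (0 < n <= d)%N -> (d * k = n * (30 * t))%N -> (m < p)%N ->
  exists2 u : F,
    pochhammer (n%:R / d%:R : F) (p * q + m) =
      p%:R ^+ (q + (k < m)) * pochhammer (n%:R / d%:R) (q + (k < m)) * u &
    exists2 v : 'F_p, v != 0 & reduces u ((\prod_(x : 'F_p | x != 0) x) ^+ q * v)
      /\ pochhammer (n%:R / d%:R) m = if (k < m)%N then 0 else v.
Proof.
move=> d31 nd kE mp.
have dF : d%:R != 0 :> F by rewrite pnatr_eq0; lia.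
have dFp := natr_Fp_neq0 d31.
have bk := frac_shift_Fp d31 kE.
have ak : n%:R / d%:R + k%:R = p%:R * (n%:R / d%:R) :> F.
  apply: (mulfI dF); rewrite mulrDr -natrM kE pE -natr1 !natrM; field.
  exact: dF.
have k_lt : (k < p)%N by nia.
have [u uE ur] := pochhammer_block p_pr k_lt ak (reduces_frac n dFp) bk q (ltnW mp).
exists u => //; exists (unit_pochhammer (n%:R / d%:R) k m).
  by apply: unit_pochhammer_neq0 => //; exact: ltnW.
by split=> //; exact: pochhammer_unit.
Qed.

Lemma reduces_neq0 (x : F) (y : 'F_p) : reduces x y -> y != 0 -> x != 0.
Proof.
move=> xy; apply: contraNneq => x0; rewrite x0 in xy.
exact/eqP/(reduces_fun xy (reduces0 F p)).
Qed.

Lemma reduces_p (x : F) : (exists y : 'F_p, reduces x y) ->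
  reduces (x * p%:R) (0 : 'F_p).
Proof.
case=> y xy; rewrite -[X in reduces _ X](mulr0 y); apply: reducesM => //.
have /eqP <- : p%:R == 0 :> 'F_p by rewrite Fp_nat_eq0.
exact: reduces_nat.
Qed.

(** The parameters 1/5, 4/5, 1 have k = 6 t, 24 t, 30 t. For m <= 6 t all powers of p cancel and the
    units give coefficient m over F_p; beyond, a factor p survives while that coefficient is 0. *)
Lemma hyper_f1_lucas q m y : (m < p)%N ->
  reduces (fps_coef (hyper_f1 F) q) y ->
  reduces (fps_coef (hyper_f1 F) (p * q + m)) (y * fps_coef (hyper_f1 'F_p) m).
Proof.
move=> mp; rewrite /= -!pochhammer1.
set w := \prod_(x : 'F_p | x != 0) x.
have w0 : w ^+ q != 0 by apply/expf_neq0/prodf_neq0.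
have [u1 -> [v1 v1N0 [r1 ->]]] :=
  @pochhammer_block_frac 1 5 (6 * t) q m isT isT ltac:(lia) mp.
have [u2 -> [v2 v2N0 [r2 ->]]] :=
  @pochhammer_block_frac 4 5 (24 * t) q m isT isT ltac:(lia) mp.
have := @pochhammer_block_frac 1 1 (30 * t) q m isT isT ltac:(lia) mp.
rewrite !divr1 => -[u3 -> [v3 v3N0 [r3 ->]]].
have -> : (30 * t < m)%N = false by lia.
rewrite addn0.
have u3N0 : u3 != 0 by apply: (reduces_neq0 r3); rewrite mulf_neq0.
have pN0 : p%:R ^+ q != 0 :> F by rewrite expf_neq0 // pnatr_eq0 -lt0n prime_gt0.
have fN0 : pochhammer (1 : F) q != 0 by rewrite gt_eqF // pochhammer_gt0.
have rV : reduces (u3 ^+ 2)^-1 ((w ^+ q * v3) ^+ 2)^-1.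
  by apply: reducesV (reducesX 2 r3); rewrite expf_neq0 ?mulf_neq0.
case: ltnP => m1 yr.
  rewrite !exprD !pochhammer_addb !mul0r mulr0; set b := (24 * t < m)%N.
  set X := (X in reduces X _).
  have -> : X =
      (pochhammer (1 / 5%:R) q * pochhammer (4%:R / 5%:R) q / pochhammer 1 q ^+ 2)
      * (u1 * u2 / u3 ^+ 2) * (1 / 5%:R + q%:R) * (4%:R / 5%:R + q%:R) ^+ b
      * p%:R ^+ b * p%:R.
    by rewrite {}/X; case: b => /=; field; rewrite u3N0 pN0 fN0.
  apply: reduces_p; eexists; apply: reducesM; last exact/reducesX/reduces_nat.
  apply: reducesM; last first.
    apply/reducesX/reducesD; last exact: reduces_nat.
    exact/reduces_frac/natr_Fp_neq0.
  apply: reducesM; last first.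
    apply: reducesD; last exact: reduces_nat.
    exact/(@reduces_frac 1)/natr_Fp_neq0.
  by apply: reducesM yr _; apply: reducesM rV; exact: reducesM r1 r2.
have -> : (24 * t < m)%N = false.
  by apply/negbTE; rewrite -leqNgt (leq_trans m1) // leq_mul.
rewrite addn0.
set X := (X in reduces X _).
have -> : X = (pochhammer (1 / 5%:R) q * pochhammer (4%:R / 5%:R) q /
    pochhammer 1 q ^+ 2) * (u1 * u2 / u3 ^+ 2).
  by rewrite /X; field; rewrite u3N0 pN0 fN0.
have -> : v1 * v2 / v3 ^+ 2 = (w ^+ q * v1) * (w ^+ q * v2) / (w ^+ q * v3) ^+ 2.
  exact/esym/cancel_f1.
by apply: reducesM yr _; apply: reducesM rV; exact: reducesM r1 r2.
Qed.

(** Here k = 10 t for 1/3, 15 t for 1/2, 20 t for 2/3 and 30 t for 1. For m > 20 t the factor 2/3 +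
    q enters the denominator and may be divisible by p, whence the integrality condition on
    coefficient q + 1. *)
Lemma hyper_f2_lucas q m y : (m < p)%N ->
  reduces (fps_coef (hyper_f2 F) q) y ->
  ((20 * t < m)%N -> exists y' : 'F_p, reduces (fps_coef (hyper_f2 F) q.+1) y') ->
  reduces (fps_coef (hyper_f2 F) (p * q + m)) (y * fps_coef (hyper_f2 'F_p) m).
Proof.
move=> mp; rewrite /= -!pochhammer1.
set w := \prod_(x : 'F_p | x != 0) x.
have w0 : w ^+ q != 0 by apply/expf_neq0/prodf_neq0.
have [u1 -> [v1 v1N0 [r1 ->]]] :=
  @pochhammer_block_frac 1 3 (10 * t) q m isT isT ltac:(lia) mp.
have [u2 -> [v2 v2N0 [r2 ->]]] :=
  @pochhammer_block_frac 1 2 (15 * t) q m isT isT ltac:(lia) mp.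
have [u4 -> [v4 v4N0 [r4 ->]]] :=
  @pochhammer_block_frac 2 3 (20 * t) q m isT isT ltac:(lia) mp.
have := @pochhammer_block_frac 1 1 (30 * t) q m isT isT ltac:(lia) mp.
rewrite !divr1 => -[u3 -> [v3 v3N0 [r3 ->]]].
have -> : (30 * t < m)%N = false by lia.
rewrite addn0.
have u3N0 : u3 != 0 by apply: (reduces_neq0 r3); rewrite mulf_neq0.
have u4N0 : u4 != 0 by apply: (reduces_neq0 r4); rewrite mulf_neq0.
have p0 : p%:R != 0 :> F by rewrite pnatr_eq0 -lt0n prime_gt0.
have pN0 : p%:R ^+ q != 0 :> F by rewrite expf_neq0.
have fN0 : pochhammer (1 : F) q != 0 by rewrite gt_eqF // pochhammer_gt0.
have gN0 n : pochhammer (2%:R / 3%:R : F) n != 0.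
  by rewrite gt_eqF // pochhammer_gt0 // divr_gt0 // ltr0n.
have r : reduces (u1 * u2 ^+ 2 / (u4 * u3 ^+ 2))
    (w ^+ q * v1 * (w ^+ q * v2) ^+ 2 / (w ^+ q * v4 * (w ^+ q * v3) ^+ 2)).
  apply: reducesM; first exact: reducesM r1 (reducesX _ r2).
  apply: reducesV; last exact: reducesM r4 (reducesX _ r3).
  by rewrite !mulf_neq0 // expf_neq0 // mulf_neq0.
have rp : reduces (p%:R : F) (p%:R : 'F_p) := reduces_nat _ _ p.
have r2q : reduces (1 / 2%:R + q%:R : F) (1 / 2%:R + q%:R : 'F_p).
  by apply: reducesD (reduces_nat _ _ q); exact/(@reduces_frac 1)/natr_Fp_neq0.
have r3q : reduces (1 / 3%:R + q%:R : F) (1 / 3%:R + q%:R : 'F_p).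
  by apply: reducesD (reduces_nat _ _ q); exact/(@reduces_frac 1)/natr_Fp_neq0.
move=> yr IH; rewrite !exprD !pochhammer_addb; set X := (X in reduces X _).
have [m4|m4] := ltnP (20 * t) m; last first.
  set b := (10 * t < m)%N; set b' := (15 * t < m)%N.
  have XE : X = pochhammer (1 / 3%:R) q * pochhammer (1 / 2%:R) q ^+ 2 /
      (pochhammer (2%:R / 3%:R) q * pochhammer 1 q ^+ 2) *
      (u1 * u2 ^+ 2 / (u4 * u3 ^+ 2)) * ((1 / 3%:R + q%:R) * p%:R) ^+ b *
      ((1 / 2%:R + q%:R) ^+ 2 * p%:R * p%:R) ^+ b'.
    rewrite /X (ltnNge (20 * t)) m4 /= /b /b' {X}.
    move: (1 / 3%:R + q%:R) (1 / 2%:R + q%:R) => c3 c4.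
    case: (10 * t < m)%N; case: (15 * t < m)%N => /=; field;
    by rewrite u3N0 u4N0 pN0 fN0 gN0.
  rewrite XE {X XE}.
  move: (_ * (u1 * _ / _)) (reducesM yr r) => A rA; rewrite /b' {b'}.
  case: ltnP => m2.
    rewrite /= expr1 expr0n /= !(mulr0, mul0r) mulrA; apply: reduces_p.
    eexists; apply: reducesM (reducesM (reducesX 2 r2q) rp).
    exact: reducesM rA (reducesX _ (reducesM r3q rp)).
  rewrite mulr1 /b {b}; case: ltnP => m1.
    rewrite /= expr1 mulrA !(mulr0, mul0r); apply: reduces_p.
    by eexists; exact: reducesM rA r3q.
  rewrite mulr1 /=; suff <- : y * (w ^+ q * v1 * (w ^+ q * v2) ^+ 2 /
    (w ^+ q * v4 * (w ^+ q * v3) ^+ 2)) = y * (v1 * v2 ^+ 2 / (v4 * v3 ^+ 2)) by [].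
  by congr (y * _); exact: cancel_f2.
(* The factor 2/3 + q is absorbed into coefficient q + 1, which leaves (1 + q)^2 p^2 times integral
   quantities. *)
have [y' yr'] := IH m4.
have m1 : (10 * t < m)%N by apply: leq_ltn_trans m4; rewrite leq_mul.
have m2 : (15 * t < m)%N by apply: leq_ltn_trans m4; rewrite leq_mul.
rewrite m1 !mul0r mulr0.
pose U := pochhammer (1 / 3%:R : F) q.+1 * pochhammer (1 / 2%:R : F) q.+1 ^+ 2 /
  (pochhammer (2%:R / 3%:R : F) q.+1 * pochhammer 1 q.+1 ^+ 2).
have -> : X = U * (u1 * u2 ^+ 2 / (u4 * u3 ^+ 2)) * (1 + q%:R) ^+ 2 * p%:R * p%:R.
  rewrite /X /U m1 m2 m4 /= !pochhammerS {X}.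
  have c1N0 : 1 + q%:R != 0 :> F by rewrite gt_eqF // ltr_pwDl ?ler0n ?ltr01.
  have c2N0 : 2%:R / 3%:R + q%:R != 0 :> F.
    by rewrite gt_eqF // ltr_wpDr ?ler0n // divr_gt0 // ltr0n.
  move: (1 + q%:R) (2%:R / 3%:R + q%:R) c1N0 c2N0 => c1 c2 c1N0 c2N0.
  move: (1 / 3%:R + q%:R) (1 / 2%:R + q%:R) => c3 c4; field.
  by rewrite u3N0 u4N0 pN0 p0 fN0 gN0 c1N0 c2N0.
apply: (reduces_p); eexists; apply: reducesM rp.
have r1q : reduces (1 + q%:R : F) (1 + q%:R : 'F_p).
  exact: reducesD (reduces1 _ _) (reduces_nat _ _ q).
by apply: reducesM (reducesX _ r1q); exact: reducesM yr' r.
Qed.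

Lemma hyper_f1_integral n : exists y : 'F_p, reduces (fps_coef (hyper_f1 F) n) y.
Proof.
elim/ltn_ind: n => -[|n] IHn.
  by exists 1; rewrite hyper_f1_coef0; exact: reduces1.
have [y /hyper_f1_lucas yr] := IHn (n.+1 %/ p)%N (ltn_Pdiv (prime_gt1 p_pr) (ltn0Sn n)).
rewrite (divn_eq n.+1 p) mulnC; eexists; apply: yr.
by rewrite ltn_mod prime_gt0.
Qed.

(** Strong induction along n = p q + m; when m > 20 t, also q + 1 < n, so coefficient q + 1 is
    already known to be integral. *)
Lemma hyper_f2_integral n : exists y : 'F_p, reduces (fps_coef (hyper_f2 F) n) y.
Proof.
elim/ltn_ind: n => -[|n] IHn.
  by exists 1; rewrite hyper_f2_coef0; exact: reduces1.
have [y /hyper_f2_lucas yr] := IHn (n.+1 %/ p)%N (ltn_Pdiv (prime_gt1 p_pr) (ltn0Sn n)).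
rewrite (divn_eq n.+1 p) mulnC; eexists; apply: yr.
  by rewrite ltn_mod prime_gt0.
move=> lt_m; apply: IHn; rewrite {2}(divn_eq n.+1 p).
have : (n.+1 %/ p * 1 <= n.+1 %/ p * p)%N by rewrite leq_mul // prime_gt0.
lia.
Qed.

(** In F_p the factorial n! vanishes for n >= p, so [hyper_f1 'F_p] is meaningful only below p; [g]
    is obtained instead by reducing the coefficients over [F]. *)
Lemma hyper_f1_reduction : exists2 g : fps 'F_p, fps_reduces (hyper_f1 F) g &
  forall q m, (m < p)%N ->
    fps_coef g (p * q + m) = fps_coef g q * fps_coef (hyper_f1 'F_p) m.
Proof.
have [g gP] := choice hyper_f1_integral; exists (Fps g) => // q m mp /=.
exact: reduces_fun (gP _) (hyper_f1_lucas mp (gP q)).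
Qed.

Lemma hyper_f2_reduction : exists2 g : fps 'F_p, fps_reduces (hyper_f2 F) g &
  forall q m, (m < p)%N ->
    fps_coef g (p * q + m) = fps_coef g q * fps_coef (hyper_f2 'F_p) m.
Proof.
have [g gP] := choice hyper_f2_integral; exists (Fps g) => // q m mp /=.
apply: reduces_fun (gP _) (hyper_f2_lucas mp (gP q) _) => _.
exact: hyper_f2_integral.
Qed.

End Lucas.

(** * Relations over F_p and the Frobenius endomorphism *)

Section Frobenius.
Variables (p : nat) (p_pr : prime p).
Local Notation toF := (@fps_of_poly 'F_p).

Lemma Fp_expp (x : 'F_p) : x ^+ p = x.
Proof. by have := expf_card x; rewrite card_Fp. Qed.

Lemma poly_Fp_expp (P : {poly 'F_p}) : P ^+ p = P \Po 'X^p.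
Proof.
have pP : p \in [pchar {poly 'F_p}] by rewrite pchar_poly; exact: pchar_Fp.
elim/poly_ind: P => [|P c IHP]; first by rewrite expr0n gtn_eqF ?prime_gt0 // comp_poly0.
rewrite -(pFrobenius_autE pP) rmorphD rmorphM /= !pFrobenius_autE IHP.
by rewrite comp_polyD comp_polyM comp_polyX comp_polyC -rmorphXn /= Fp_expp.
Qed.

Lemma fps_coef_exp_trunc (f : fps 'F_p) e m n : (n < m)%N ->
  fps_coef (f ^+ e) n = ((fps_trunc m f) ^+ e)`_n.
Proof.
elim: e n => [|e IHe] n nm; first by rewrite coef1 fps_coef1.
rewrite !exprS coefM fps_coefM; apply: eq_bigr => i _.
have i_n : (i <= n)%N by rewrite -ltnS.
by rewrite coef_fps_trunc ?(leq_ltn_trans i_n) // IHe // (leq_ltn_trans (leq_subr _ _)).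
Qed.

Lemma fps_coef_expp (f : fps 'F_p) n :
  fps_coef (f ^+ p) n = if (p %| n)%N then fps_coef f (n %/ p) else 0.
Proof.
rewrite (@fps_coef_exp_trunc _ _ n.+1) // poly_Fp_expp coef_comp_poly_Xn ?prime_gt0 //.
by case: ifP => // _; rewrite coef_fps_trunc // ltnS leq_div.
Qed.

Lemma pchar_fps : p \in [pchar (fps 'F_p)].
Proof.
apply: (rmorph_pchar (toF \o polyC)); exact: pchar_Fp.
Qed.

(** Since g^p = g(z^p) is supported on multiples of p, only the index n mod p of the truncation
    contributes to the coefficient of z^n. *)
Lemma fps_lucas_eq (g v : fps 'F_p) :
  (forall q m, (m < p)%N -> fps_coef g (p * q + m) = fps_coef g q * fps_coef v m) ->
  g = toF (fps_trunc p v) * g ^+ p.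
Proof.
move=> gv; apply/fpsP => n; have mp : (n %% p < p)%N by rewrite ltn_mod prime_gt0.
have i0 : (n %% p < n.+1)%N by rewrite ltnS leq_mod.
rewrite fps_coefM (bigD1 (Ordinal i0)) //= big1 => [|i /eqP/val_eqP /= i_ne].
  rewrite addr0 coef_fps_trunc // fps_coef_expp.
  have -> : (n - n %% p = n %/ p * p)%N by rewrite {1}(divn_eq n p) addnK.
  rewrite dvdn_mull // mulnK ?prime_gt0 //.
  by rewrite {1}(divn_eq n p) mulnC gv // mulrC.
rewrite coef_poly; case: ltnP => ip; last by rewrite mul0r.
rewrite fps_coef_expp ifN ?mulr0 //; apply: contraNN i_ne => pni.
have i_n : (i <= n)%N by rewrite -ltnS.
by rewrite -[X in (X %% p)%N](subnKC i_n) -modnDmr (eqP pni) addn0 modn_small.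
Qed.

Lemma frobenius_relation (T : finType) (G : T -> fps 'F_p) (B : T -> {poly 'F_p})
    (c : {ffun T -> {poly 'F_p}}) :
    (forall t, G t = toF (B t) * G t ^+ p) -> (forall t, G t != 0) ->
    c != 0 -> \sum_t toF (c t) * G t = 0 ->
  exists s t, s != t /\ exists a b, [/\ a != 0, b != 0 &
    a ^+ p.-1 * B s = b ^+ p.-1 * B t].
Proof.
move=> GB G0; have B0 t : B t != 0.
  by apply: contraNneq (G0 t) => Bt; rewrite GB Bt rmorph0 mul0r.
have toF_eq0 P : (toF P == 0) = (P == 0).
  by rewrite -(inj_eq (@fps_of_poly_inj _)) rmorph0.
have expS (x : {poly 'F_p}) : x ^+ p = x * x ^+ p.-1.
  by rewrite -exprS prednK ?prime_gt0.
have [n] := ubnP #|[pred t | c t != 0]|; elim: n c => // n IHn c.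
rewrite ltnS => cn c0 cG.
have [s cs] : exists s, c s != 0.
  apply/existsP; apply: contraNT c0 => /existsPn nc; apply/eqP/ffunP => t.
  by have := nc t; rewrite negbK ffunE => /eqP.
(* The p-th power of the relation involves G t ^+ p, which is G t divided by B t; multiplying by the
   product of all [B u] clears these denominators. *)
pose B' t := \prod_(u | u != t) B u.
have BB' t : B t * B' t = \prod_u B u by rewrite [RHS](bigD1 t).
have B'0 t : B' t != 0 by apply/prodf_neq0.
have cG' : \sum_t toF (c t ^+ p * B' t) * G t = 0.
  transitivity (toF (\prod_u B u) * (\sum_t toF (c t) * G t) ^+ p); last first.
    by rewrite cG expr0n gtn_eqF ?prime_gt0 // mulr0.
  rewrite -(pFrobenius_autE pchar_fps) rmorph_sum mulr_sumr; apply: eq_bigr => t _.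
  rewrite [LHS]/= {1}GB /= rmorphM /= !pFrobenius_autE -(BB' t) !rmorphM rmorphXn /=.
  by rewrite exprMn; ring.
(* This combination of the relation and its Frobenius image cancels the coefficient at [s]: it is a
   shorter relation, or it is zero and its entry at another [t] gives the claim. *)
pose e := [ffun t => c s * (c t ^+ p * B' t) - c s ^+ p * B' s * c t].
have eG : \sum_t toF (e t) * G t = 0.
  rewrite (eq_bigr (fun t => toF (c s) * (toF (c t ^+ p * B' t) * G t) -
                         toF (c s ^+ p * B' s) * (toF (c t) * G t))).
    by rewrite sumrB -!mulr_sumr cG cG' !mulr0 subr0.
  by move=> t _; rewrite ffunE rmorphB !rmorphM /=; ring.
have es : e s = 0.
  by rewrite ffunE; ring.
have [e0|e_neq0] := eqVneq e 0; last first.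
  apply: IHn e_neq0 eG; apply: leq_trans cn; apply/proper_card/properP; split.
    apply/subsetP => t; rewrite !inE; apply: contraNneq => ct.
    by rewrite ffunE ct expr0n gtn_eqF ?prime_gt0 //= mul0r !mulr0 subr0.
  by exists s; rewrite !inE ?es ?eqxx.
have [t /andP[ts ct]] : exists t, (t != s) && (c t != 0).
  apply/existsP; apply: contraTT (G0 s) => /existsPn nc.
  have := cG; rewrite (bigD1 s) //= big1 => [|t ts].
    by rewrite addr0 => /eqP; rewrite mulf_eq0 toF_eq0 (negPf cs) /= negbK.
  by have := nc t; rewrite ts negbK => /eqP->; rewrite rmorph0 mul0r.
exists s, t; split; first by rewrite eq_sym.
exists (c t), (c s); split=> //.
have /ffunP/(_ t) := e0; rewrite !ffunE => /eqP; rewrite subr_eq0 => /eqP E.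
apply: (mulfI (mulf_neq0 cs (mulf_neq0 ct (mulf_neq0 (B'0 s) (B'0 t))))).
transitivity (B s * B' s * (c s * (c t ^+ p * B' t))).
  by rewrite expS; ring.
by rewrite E BB' -(BB' t) expS; ring.
Qed.

End Frobenius.

(** * Multiplicities of the roots of the truncations *)

(** The value of [q] at x decides whether the order of the zero drops exactly by k; in positive
    characteristic the falling factorial may vanish. *)
Lemma derivn_mul_XsubCX (R : comNzRingType) (h : {poly R}) (x : R) m k :
  (k <= m)%N -> exists2 q, (h * ('X - x%:P) ^+ m)^`(k) = ('X - x%:P) ^+ (m - k) * q &
    q.[x] = (m ^_ k)%:R * h.[x].
Proof.
elim: k => [|k IHk] km.
  by exists h; [rewrite derivn0 subn0 mulrC | rewrite ffactn0 mul1r].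
have [q qE qx] := IHk (ltnW km).
exists (q *+ (m - k) + ('X - x%:P) * q^`()).
  rewrite derivnS qE derivM deriv_exp derivXsubC mul1r.
  have -> : (m - k = (m - k.+1).+1)%N by rewrite -subSn.
  by rewrite mulrDr mulrnAr mulrnAl exprSr mulrA.
by rewrite !hornerE subrr mul0r addr0 hornerMn qx -mulr_natl ffactnSr natrM; ring.
Qed.

Lemma prime_dvd_fact p n : prime p -> (p %| n`!)%N -> (p <= n)%N.
Proof.
move=> p_pr; elim: n => [|n IHn]; first by rewrite dvdn1 => /eqP p1; rewrite p1 in p_pr.
by rewrite factS Euclid_dvdM // => /orP[/dvdn_leq->//|/IHn/leqW].
Qed.

(* At a zero of order m >= r the term of order r of the equation has order
   exactly m - r, since m ^_ r is nonzero mod p, and the others have higher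
   order. *)
Lemma mup_lt_ode (K : fieldType) (p r : nat) (P : {poly K}) (Q : nat -> {poly K}) x :
  p \in [pchar K] -> P != 0 -> (size P <= p)%N ->
  \sum_(k < r.+1) Q k * P^`(k) = 0 -> ~~ root (Q r) x -> (mup x P < r)%N.
Proof.
move=> pK P0 Pp ode Qx; have [m [h]] := multiplicity_XsubC P x.
rewrite P0 /= => hx PE; have h0 : h != 0 by apply: contraNneq hx => ->; rewrite root0.
have mP : mup x P = m by rewrite PE mupMr // mup_XsubCX eqxx.
rewrite mP ltnNge; apply/negP => rm.
have mp : (m < p)%N.
  apply: leq_trans Pp; rewrite PE size_mul ?expf_neq0 ?polyXsubC_eq0 //.
  by rewrite size_exp_XsubC addnS /= -[X in (X < _)%N]add0n ltn_add2r lt0n size_poly_eq0.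
have D (k : 'I_r.+1) : exists q, P^`(k) = ('X - x%:P) ^+ (m - k) * q /\
    q.[x] = (m ^_ k)%:R * h.[x].
  have km : (k <= m)%N by rewrite (leq_trans _ rm) // -ltnS.
  by rewrite PE; have [q qE qx] := derivn_mul_XsubCX h x km; exists q.
have [q qP] := choice D.
(* The equation divided by the (m - r)-th power of X - x; at x only the term k = r remains. *)
have : \sum_(k < r.+1) Q k * ('X - x%:P) ^+ (r - k) * q k = 0.
  have X0 : ('X - x%:P) ^+ (m - r) != 0 by rewrite expf_neq0 ?polyXsubC_eq0.
  apply: (mulfI X0); rewrite mulr0 -[RHS]ode mulr_sumr; apply: eq_bigr => k _.
  have kr : (k <= r)%N by rewrite -ltnS.
  have [-> _] := qP k; have -> : (m - k = (m - r) + (r - k))%N by lia.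
  by rewrite exprD; ring.
rewrite big_ord_recr /= => /(congr1 (horner^~ x)).
rewrite hornerD horner_sum big1 => [|k _]; last first.
  rewrite !hornerM horner_exp !hornerE subrr expr0n subn_eq0 leqNgt ltn_ord.
  by rewrite mulr0 mul0r.
rewrite add0r subnn expr0 mulr1 hornerM horner0 => /eqP.
have [_ ->] := qP ord_max; rewrite mulf_eq0 -rootE (negPf Qx) mulf_eq0 -rootE.
rewrite (negPf hx) orbF /= -(dvdn_pcharf pK).
move=> pm; have : (p %| m`!)%N by rewrite -(ffact_fact rm) dvdn_mulr.
by move/(prime_dvd_fact (pcharf_prime pK)); rewrite leqNgt mp.
Qed.

(** The roots other than y agree with multiplicity, and equality of degrees then forces agreement at
    y. The point y = 1 is where the differential equations give no bound. *)
Lemma eq_mup_proportional (K : closedFieldType) (U V : {poly K}) (y : K) :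
  U != 0 -> V != 0 -> size U = size V -> (forall x, x != y -> mup x U = mup x V) ->
  exists c, U = c *: V.
Proof.
have [r UE] := closed_field_poly_normal U; have [s VE] := closed_field_poly_normal V.
move=> U0 V0 sUV UV.
have lU : lead_coef U != 0 by rewrite lead_coef_eq0.
have lV : lead_coef V != 0 by rewrite lead_coef_eq0.
have count_mup (W : {poly K}) (l : K) (w : seq K) (x : K) :
    l != 0 -> W = l *: \prod_(z <- w) ('X - z%:P) ->
    mup x W = count_mem x w.
  move=> l0 ->; rewrite -mul_polyC mupMr ?mu_prod_XsubC //.
  by rewrite rootE hornerC.
have size_rs : size r = size s.
  by move: sUV; rewrite UE VE !size_scale // !size_prod_XsubC => -[].
have rs x : x != y -> count_mem x r = count_mem x s.
  by move=> xy; rewrite -(count_mup U _ _ x lU UE) -(count_mup V _ _ x lV VE) UV.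
have filt : perm_eq [seq x <- r | x != y] [seq x <- s | x != y].
  apply/allP => x _ /=; rewrite !count_filter; have [->|xy] := eqVneq x y.
    by rewrite !(@eq_count _ _ pred0) ?count_pred0 // => z /=; case: eqP.
  rewrite !(@eq_count _ (predI _ _) (pred1 x)) ?rs // => z /=;
  by case: eqVneq => //= ->.
have rs_perm : perm_eq r s.
  apply/allP => x _ /=; have [->|/rs ->//] := eqVneq x y.
  move/perm_size: filt; rewrite !size_filter => filt.
  have := count_predC (pred1 y) r; have := count_predC (pred1 y) s.
  rewrite -size_rs -[count (predC _) s]filt => <- /addIn ->; exact: eqxx.
exists (lead_coef U / lead_coef V); rewrite {1}UE (perm_big _ rs_perm) /=.
by rewrite {2}VE scalerA divfK.
Qed.

Lemma coef0_exp (R : comNzRingType) (P : {poly R}) n : P`_0 = 1 -> (P ^+ n)`_0 = 1.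
Proof. by move=> P0; rewrite -!horner_coef0 horner_exp horner_coef0 P0 expr1n. Qed.

(** On polynomials with constant term 1 the coefficient of z is additive, which turns product
    identities into linear ones. *)
Lemma coef1_mul (R : comNzRingType) (P Q : {poly R}) :
  P`_0 = 1 -> Q`_0 = 1 -> (P * Q)`_1 = P`_1 + Q`_1.
Proof. by move=> P0 Q0; rewrite coefM !big_ord_recl big_ord0 /= P0 Q0; ring. Qed.

Lemma coef1_exp (R : comNzRingType) (P : {poly R}) n :
  P`_0 = 1 -> (P ^+ n)`_1 = n%:R * P`_1.
Proof.
move=> P0; elim: n => [|n IHn]; first by rewrite expr0 coef1 mul0r.
by rewrite exprS coef1_mul ?coef0_exp // IHn -natr1; ring.
Qed.

Section Multiplicities.
Variables (K : closedFieldType) (p t : nat).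
Hypotheses (pK : p \in [pchar K]) (pE : p = (30 * t).+1).
Variables P1 P2 : {poly K}.
Hypotheses (sP1 : size P1 = (6 * t).+1) (sP2 : size P2 = (10 * t).+1).
Hypotheses (P1_0 : P1`_0 = 1) (P2_0 : P2`_0 = 1).
Hypothesis rec1 : forall n, (25 * n.+1 ^ 2)%:R * P1`_n.+1 =
  ((5 * n + 1) * (5 * n + 4))%:R * P1`_n.
Hypothesis rec2 : forall n, (4 * n.+1 ^ 2 * (3 * n + 2))%:R * P2`_n.+1 =
  ((3 * n + 1) * (2 * n + 1) ^ 2)%:R * P2`_n.

Let nat_neq0 d : (0 < d < 31)%N -> (0 < t)%N -> d%:R != 0 :> K.
Proof. by move=> d31 t0; rewrite -(dvdn_pcharf pK) gtnNdvd; lia. Qed.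

Let t_eq : 30%:R * t%:R = -1 :> K.
Proof.
apply/eqP; rewrite -addr_eq0 -natrM natr1 -(dvdn_pcharf pK) -[X in (_ %| X)%N]pE.
exact: dvdnn.
Qed.

(** With D = z d/dz, this is 25 D^2 - z (5 D + 1) (5 D + 4) applied to [P1] and divided by z; its
    coefficients are [rec1]. *)
Let ode1 : 25%:R *: (P1^`(2) * 'X - P1^`(2) * 'X^2) +
  (25%:R *: P1^`(1) - 50%:R *: (P1^`(1) * 'X)) - 4%:R *: P1 = 0.
Proof.
rewrite derivn1 derivnS derivn1; apply/polyP => n; rewrite coef0.
transitivity ((25 * n.+1 ^ 2)%:R * P1`_n.+1 -
    ((5 * n + 1) * (5 * n + 4))%:R * P1`_n); last by rewrite rec1 subrr.
rewrite !(coefD, coefN, coefZ, coefMX, coefMXn, coef_deriv).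
by case: n => [|[|n]]; rewrite ?(subSS, subn0) /=; ring.
Qed.

(** Likewise for 4 D^2 (3 D - 1) - z (3 D + 1) (2 D + 1)^2 and [rec2]. *)
Let ode2 : 12%:R *: (P2^`(3) * 'X^2 - P2^`(3) * 'X^3) +
  (32%:R *: (P2^`(2) * 'X) - 52%:R *: (P2^`(2) * 'X^2)) +
  (8%:R *: P2^`(1) - 35%:R *: (P2^`(1) * 'X)) - P2 = 0.
Proof.
rewrite !derivnS derivn0; apply/polyP => n; rewrite coef0.
transitivity ((4 * n.+1 ^ 2 * (3 * n + 2))%:R * P2`_n.+1 -
    ((3 * n + 1) * (2 * n + 1) ^ 2)%:R * P2`_n); last by rewrite rec2 subrr.
rewrite !(coefD, coefN, coefZ, coefMX, coefMXn, coef_deriv).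
by case: n => [|[|[|n]]]; rewrite ?(subSS, subn0) /=; ring.
Qed.

(** The leading coefficient 25 z (1 - z) of the equation of order 2 vanishes only at 0 and 1, and
    [P1] is 1 at 0. *)
Lemma mup_hyper1 x : (0 < t)%N -> x != 1 -> (mup x P1 <= 1)%N.
Proof.
move=> t0 x1; have P10 : P1 != 0 by rewrite -size_poly_eq0 sP1.
have [->|x0] := eqVneq x 0.
  by rewrite mupNroot // rootE horner_coef0 P1_0 oner_eq0.
pose Q k : {poly K} := nth 0 [:: (- 4%:R)%:P; 25%:R%:P - 50%:R%:P * 'X;
  25%:R%:P * ('X - 'X^2)] k.
apply: (@mup_lt_ode K p 2 P1 Q) => //; first by rewrite sP1 pE; lia.
  rewrite -[RHS]ode1 -!mul_polyC !big_ord_recl big_ord0 /Q /= /bump /=.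
  by rewrite rmorphN /=; ring.
rewrite rootE /Q /= !hornerE.
have -> : x - x ^+ 2 = x * (1 - x) by ring.
by rewrite !mulf_neq0 ?nat_neq0 // subr_eq0 eq_sym.
Qed.

Lemma mup_hyper2 x : (0 < t)%N -> x != 1 -> (mup x P2 <= 2)%N.
Proof.
move=> t0 x1; have P20 : P2 != 0 by rewrite -size_poly_eq0 sP2.
have [->|x0] := eqVneq x 0.
  by rewrite mupNroot // rootE horner_coef0 P2_0 oner_eq0.
pose Q k : {poly K} := nth 0 [:: - 1; 8%:R%:P - 35%:R%:P * 'X;
  32%:R%:P * 'X - 52%:R%:P * 'X^2; 12%:R%:P * ('X^2 - 'X^3)] k.
apply: (@mup_lt_ode K p 3 P2 Q) => //; first by rewrite sP2 pE; lia.
  rewrite -[RHS]ode2 -!mul_polyC !big_ord_recl big_ord0 /Q /= /bump /=.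
  by ring.
rewrite rootE /Q /= !hornerE.
have -> : x ^+ 2 - x ^+ 3 = x ^+ 2 * (1 - x) by ring.
by rewrite !mulf_neq0 ?expf_neq0 ?nat_neq0 // subr_eq0 eq_sym.
Qed.

Let P1_neq0 : P1 != 0. Proof. by rewrite -size_poly_eq0 sP1. Qed.
Let P2_neq0 : P2 != 0. Proof. by rewrite -size_poly_eq0 sP2. Qed.

Let P1_1 : 25%:R * P1`_1 = 4%:R.
Proof. by have := rec1 0; rewrite P1_0 mulr1. Qed.

Let P2_1 : 8%:R * P2`_1 = 1.
Proof. by have := rec2 0; rewrite P2_0 mulr1. Qed.

Let unitX_0 : (1 - 'X : {poly K})`_0 = 1.
Proof. by rewrite coefB coefX coef1 subr0. Qed.

Let unitX_1 : (1 - 'X : {poly K})`_1 = -1.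
Proof. by rewrite coefB coefX coef1 sub0r. Qed.

Let size_unitX n : size ((1 - 'X : {poly K}) ^+ n) = n.+1.
Proof.
have := size_exp (1 - 'X : {poly K}) n.
have -> : size (1 - 'X : {poly K}) = 2 by rewrite -opprB size_polyN size_XsubC.
have /negPf : (1 - 'X : {poly K}) ^+ n != 0.
  by rewrite expf_neq0 // -size_poly_eq0 -opprB size_polyN size_XsubC.
by rewrite -size_poly_eq0; case: size => //= m _ ->; rewrite mul1n.
Qed.

Let mup_unitX n x : x != 1 -> mup x ((1 - 'X : {poly K}) ^+ n) = 0%N.
Proof.
move=> x1; rewrite mupNroot // rootE horner_exp !hornerE expf_neq0 //.
by rewrite subr_eq0 eq_sym.
Qed.

Let eq_mup (U V : {poly K}) : U != 0 -> V != 0 -> size U = size V ->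
  (forall x, x != 1 -> mup x U = mup x V) -> U`_0 = 1 -> V`_0 = 1 -> U = V.
Proof.
move=> U0 V0 sUV UV U1 V1; have [c UE] := eq_mup_proportional U0 V0 sUV UV.
by move: U1; rewrite UE coefZ V1 mulr1 => ->; rewrite scale1r.
Qed.

Let unitX_neq0 n : (1 - 'X : {poly K}) ^+ n != 0.
Proof. by rewrite -size_poly_eq0 size_unitX. Qed.

(** Otherwise [P1] would be (1 - z)^(6 t), and comparing coefficients of z would give 4/25 = - 6 t =
    1/5. *)
Lemma hyper1_root : (0 < t)%N -> exists2 x, x != 1 & mup x P1 = 1%N.
Proof.
move=> t0; apply: contrapT => nex.
have P1E : P1 = (1 - 'X) ^+ (6 * t).
  apply: eq_mup; rewrite ?size_unitX ?coef0_exp // => x x1; rewrite mup_unitX //.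
  have := mup_hyper1 t0 x1; case E: (mup x P1) => [|[|?]] // _.
  by case: nex; exists x.
have := P1_1; rewrite P1E coef1_exp // unitX_1 natrM => E.
have /eqP := oner_neq0 K; apply.
have -> : 1 = (25%:R * (6%:R * t%:R * -1) - 4%:R) + 5%:R * (30%:R * t%:R + 1) :> K.
  by ring.
by rewrite E t_eq; ring.
Qed.

(** Otherwise [P2] would be (1 - z)^(10 t), whence 1/8 = - 10 t = 1/3, that is 5 = 0. *)
Lemma hyper2_root : (0 < t)%N -> exists2 x, x != 1 & mup x P2 != 0%N.
Proof.
move=> t0; apply: contrapT => nex.
have P2E : P2 = (1 - 'X) ^+ (10 * t).
  apply: eq_mup; rewrite ?size_unitX ?coef0_exp // => x x1; rewrite mup_unitX //.
  by apply: contrapT => /eqP m0; case: nex; exists x.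
have := P2_1; rewrite P2E coef1_exp // unitX_1 natrM => E.
have /eqP := nat_neq0 (isT : (0 < 5 < 31)%N) t0; apply.
have -> : 5%:R = 3%:R * (8%:R * (10%:R * t%:R * -1)) - 3%:R
  + 8%:R * (30%:R * t%:R + 1) :> K by ring.
by rewrite E t_eq; ring.
Qed.

Lemma hyper_mup_independent d (i0 j0 i1 j1 : nat) (a b : {poly K}) :
    (101 < p)%N -> (3 * d < p.-1)%N ->
    (i0 <= d)%N -> (j0 <= d)%N -> (i1 <= d)%N -> (j1 <= d)%N ->
    (i0, j0) != (i1, j1) -> a != 0 -> b != 0 ->
  a ^+ p.-1 * (P1 ^+ i0 * P2 ^+ j0) != b ^+ p.-1 * (P1 ^+ i1 * P2 ^+ j1).
Proof.
move=> p101 dp i0d j0d i1d j1d ij a0 b0; apply/eqP => E.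
have t0 : (0 < t)%N by lia.
have mupX n x (W : {poly K}) : W != 0 -> mup x (W ^+ n) = (n * mup x W)%N.
  move=> W0; elim: n => [|n IHn]; first by rewrite mupNroot // rootE hornerE oner_eq0.
  by rewrite exprS mupM ?expf_neq0 // IHn mulSn.
(* The multiplicities at x agree modulo p - 1, and both sides are at most d + 2 d < p - 1. *)
have key x : x != 1 ->
    (i0 * mup x P1 + j0 * mup x P2 = i1 * mup x P1 + j1 * mup x P2)%N.
  move=> x1; have m1 := mup_hyper1 t0 x1; have m2 := mup_hyper2 t0 x1.
  have := congr1 (mup x) E.
  rewrite !mupM ?mulf_neq0 ?expf_neq0 // !mupX //.
  move: (mup x a) (mup x b) (mup x P1) (mup x P2) m1 m2 => ma mb m1 m2 h1 h2.
  have small i j : (i <= d -> j <= d -> i * m1 + j * m2 < p.-1)%N.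
    move=> ile jle; apply: leq_ltn_trans dp.
    have := leq_mul ile h1; have := leq_mul jle h2; lia.
  move/(congr1 (modn^~ p.-1)); rewrite ![(p.-1 * _)%N]mulnC !modnMDl.
  by rewrite !modn_small ?small.
have [x1 x1N1 m1] := hyper1_root t0; have [x2 x2N1 m2] := hyper2_root t0.
(* By [key] at [x1], i0 - i1 = (j1 - j0) m with m the multiplicity of [x1] in [P2]. The root [x2]
   excludes m = 0, and j0 = j1 would force i0 = i1. *)
have [m m12 mE] : exists2 m, (0 < m <= 2)%N &
    forall x, x != 1 -> mup x P2 = (m * mup x P1)%N.
  have k1 := key _ x1N1; rewrite m1 !muln1 in k1.
  have k2 := key _ x2N1; have h1 := mup_hyper1 t0 x2N1.
  have h2 := mup_hyper2 t0 x1N1; have h3 := mup_hyper2 t0 x2N1.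
  move: ij; rewrite xpair_eqE negb_and => ij.
  exists (mup x1 P2); first by nia.
  move=> x xN1; have k := key _ xN1.
  have h4 := mup_hyper1 t0 xN1; have h5 := mup_hyper2 t0 xN1.
  case: (mup x P1) h4 k => [|[|//]] _ k; nia.
(* The powers of 1 - z equalize the degrees without affecting the roots other than 1. *)
have PE : P2 * (1 - 'X) ^+ (m * (6 * t)) = P1 ^+ m * (1 - 'X) ^+ (10 * t).
  apply: eq_mup.
  - by rewrite mulf_neq0 ?unitX_neq0.
  - by rewrite mulf_neq0 ?unitX_neq0 ?expf_neq0.
  - rewrite !size_mul ?unitX_neq0 ?expf_neq0 // !size_unitX sP2; have := size_exp P1 m.
    have : P1 ^+ m != 0 by rewrite expf_neq0.
    by rewrite -size_poly_eq0 sP1; case: size => //= k _ ->; lia.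
  - by move=> x xN1; rewrite !mupM ?unitX_neq0 ?expf_neq0 // !mup_unitX // mupX //
       !addn0 mE.
  - by rewrite coef0M coef0_exp // P2_0 mulr1.
  - by rewrite coef0M !coef0_exp // mulr1.
have := congr1 (fun W : {poly K} => W`_1) PE.
rewrite !coef1_mul ?coef0_exp // !coef1_exp // unitX_1 !natrM => {}E.
have nat_large n : (0 < n < 102)%N -> n%:R != 0 :> K.
  move=> /andP[n0 n102]; rewrite -(dvdn_pcharf pK) gtnNdvd //.
  exact: leq_trans p101.
(* With 30 t = -1 the coefficients of z give 1/8 + m/5 = 4 m/25 + 1/3, that is 24 m = 125. For m =
   1, 2 this would make 101 or 77 vanish, which p > 101 excludes. *)
have : 125%:R - 24%:R * m%:R = 0 :> K.
  pose e := P2`_1 + m%:R * (6%:R * t%:R) * -1 - (m%:R * P1`_1 + 10%:R * t%:R * -1).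
  transitivity (- 600%:R * e + 75%:R * (8%:R * P2`_1 - 1)
    - 24%:R * m%:R * (25%:R * P1`_1 - 4%:R)
    + (200%:R - 120%:R * m%:R) * (30%:R * t%:R + 1)); first by rewrite /e; ring.
  by rewrite /e E P1_1 P2_1 t_eq !subrr addNr; ring.
case/andP: m12 => + m_le2; case: (m) m_le2 => [|[|[|//]]] // _ _.
  by move=> h; have /eqP := nat_large 101 isT; apply; rewrite -h; ring.
by move=> h; have /eqP := nat_large 77 isT; apply; rewrite -h; ring.
Qed.

End Multiplicities.

(** * The truncated series modulo p *)

Lemma hyper_f1_ratio (K : fieldType) (a b f : K) n :
  5%:R != 0 :> K -> n.+1%:R != 0 :> K -> f != 0 ->
  (25 * n.+1 ^ 2)%:R *
    (a * (1 / 5%:R + n%:R) * (b * (4%:R / 5%:R + n%:R)) / (n.+1%:R * f) ^+ 2) =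
  ((5 * n + 1) * (5 * n + 4))%:R * (a * b / f ^+ 2).
Proof.
move=> d5; rewrite natrM natrX -natr1 => n1 f0; field.
by rewrite d5 f0 n1.
Qed.

Lemma hyper_f2_ratio (K : fieldType) (a b c f : K) n :
  2%:R != 0 :> K -> 3%:R != 0 :> K -> n.+1%:R != 0 :> K -> f != 0 -> c != 0 ->
  2%:R / 3%:R + n%:R != 0 :> K ->
  (4 * n.+1 ^ 2 * (3 * n + 2))%:R *
    (a * (1 / 3%:R + n%:R) * (b * (1 / 2%:R + n%:R)) ^+ 2 /
      (c * (2%:R / 3%:R + n%:R) * (n.+1%:R * f) ^+ 2)) =
  ((3 * n + 1) * (2 * n + 1) ^ 2)%:R * (a * b ^+ 2 / (c * f ^+ 2)).
Proof.
move=> d2 d3; rewrite !natrM -natr1 => n1 f0 c0 cn.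
have cn' : 2%:R + 3%:R * n%:R != 0 :> K.
  apply: contraNneq cn => cn; apply/eqP/(mulfI d3).
  by rewrite mulr0 mulrDr mulrCA divff // mulr1.
by field; rewrite d2 d3 f0 n1 c0 mulrC cn'.
Qed.

Section Truncation.
Variables (p t : nat).
Hypotheses (p_pr : prime p) (pE : p = (30 * t).+1) (t_gt0 : (0 < t)%N).
Local Notation A1 := (fps_trunc p (hyper_f1 'F_p)).
Local Notation A2 := (fps_trunc p (hyper_f2 'F_p)).

Let fact_neq0 n : (n < p)%N -> n`!%:R != 0 :> 'F_p.
Proof.
move=> np; rewrite Fp_nat_eq0 //; apply: contraTN np => /(prime_dvd_fact p_pr).
by rewrite leqNgt.
Qed.

Let nat_neq0 d : (0 < d < 31)%N -> d%:R != 0 :> 'F_p.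
Proof. exact: (natr_Fp_neq0 p_pr pE). Qed.

Lemma size_trunc (v : fps 'F_p) N : (N < p)%N ->
  (forall n, (n < p)%N -> (fps_coef v n == 0) = (N < n)%N) ->
  size (fps_trunc p v) = N.+1.
Proof.
move=> Np v0.
have -> : fps_trunc p v = \poly_(n < N.+1) fps_coef v n.
  apply/polyP => n; rewrite !coef_poly ltnS.
  case: (ltnP n p) => np; first by case: leqP => // Nn; apply/eqP; rewrite v0.
  by rewrite leqNgt (leq_trans Np).
by rewrite size_poly_eq //= v0 // ltnn.
Qed.

Lemma hyper_f1_Fp_eq0 n : (n < p)%N ->
  (fps_coef (hyper_f1 'F_p) n == 0) = (6 * t < n)%N.
Proof.
move=> np; rewrite /= mulf_eq0 invr_eq0 expf_eq0 (negPf (fact_neq0 np)) /= orbF.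
rewrite mulf_eq0.
rewrite (@pochhammer_Fp_eq0 p t p_pr pE t_gt0 1 5 (6 * t)) ?(ltnW np) //; last by nia.
rewrite (@pochhammer_Fp_eq0 p t p_pr pE t_gt0 4 5 (24 * t)) ?(ltnW np) //; lia.
Qed.

(** For 20 t < n < p the denominator vanishes too; the quotient is then 0 by the convention on
    division by 0. *)
Lemma hyper_f2_Fp_eq0 n : (n < p)%N ->
  (fps_coef (hyper_f2 'F_p) n == 0) = (10 * t < n)%N.
Proof.
move=> np; rewrite /= mulf_eq0 invr_eq0 mulf_eq0 expf_eq0 mulf_eq0 expf_eq0.
rewrite (negPf (fact_neq0 np)) /= orbF.
rewrite (@pochhammer_Fp_eq0 p t p_pr pE t_gt0 1 3 (10 * t)) ?(ltnW np) //; last by nia.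
rewrite (@pochhammer_Fp_eq0 p t p_pr pE t_gt0 1 2 (15 * t)) ?(ltnW np) //; last by nia.
rewrite (@pochhammer_Fp_eq0 p t p_pr pE t_gt0 2 3 (20 * t)) ?(ltnW np) //; lia.
Qed.

Lemma hyper_f1_rec n : (25 * n.+1 ^ 2)%:R * A1`_n.+1 =
  ((5 * n + 1) * (5 * n + 4))%:R * A1`_n.
Proof.
have [np|np] := ltnP n.+1 p.
  rewrite !coef_fps_trunc ?(ltnW np) //= !pochhammerS factS [(n.+1 * n`!)%:R]natrM.
  have := fact_neq0 np; rewrite factS natrM mulf_eq0 negb_or => /andP[n1 nf].
  exact: hyper_f1_ratio (nat_neq0 (isT : (0 < 5 < 31)%N)) n1 nf.
(* The left coefficient is cut off by the truncation; for n = p - 1 the right one vanishes because 6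
   t < p - 1. *)
rewrite (nth_default _ (leq_trans _ np)) ?size_poly // mulr0.
have [np'|np'] := ltnP n p; last first.
  by rewrite nth_default ?mulr0 ?(leq_trans (size_poly _ _)).
rewrite coef_fps_trunc // (_ : fps_coef _ _ = 0) ?mulr0 //; apply/eqP.
rewrite hyper_f1_Fp_eq0 //; lia.
Qed.

Lemma hyper_f2_rec n : (4 * n.+1 ^ 2 * (3 * n + 2))%:R * A2`_n.+1 =
  ((3 * n + 1) * (2 * n + 1) ^ 2)%:R * A2`_n.
Proof.
have [np|np] := ltnP n.+1 p.
  rewrite !coef_fps_trunc ?(ltnW np) //.
  have [n10|n10] := ltnP (10 * t) n.
    have /eqP-> : fps_coef (hyper_f2 'F_p) n == 0 by rewrite hyper_f2_Fp_eq0 // ltnW.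
    have /eqP-> : fps_coef (hyper_f2 'F_p) n.+1 == 0.
      by rewrite hyper_f2_Fp_eq0 // ltnW.
    by rewrite !mulr0.
  have := @pochhammer_Fp_eq0 p t p_pr pE t_gt0 2 3 (20 * t) n.+1 isT isT.
  have -> : (20 * t < n.+1)%N = false by lia.
  move=> /(_ ltac:(lia) (ltnW np)) /negbT; rewrite pochhammerS mulf_eq0 negb_or.
  case/andP=> c0 cn; rewrite /= !pochhammerS factS [(n.+1 * n`!)%:R]natrM.
  have := fact_neq0 np; rewrite factS natrM mulf_eq0 negb_or => /andP[n1 nf].
  exact: hyper_f2_ratio (nat_neq0 (isT : (0 < 2 < 31)%N))
    (nat_neq0 (isT : (0 < 3 < 31)%N)) n1 nf c0 cn.
rewrite (nth_default _ (leq_trans _ np)) ?size_poly // mulr0.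
have [np'|np'] := ltnP n p; last first.
  by rewrite nth_default ?mulr0 ?(leq_trans (size_poly _ _)).
rewrite coef_fps_trunc // (_ : fps_coef _ _ = 0) ?mulr0 //; apply/eqP.
rewrite hyper_f2_Fp_eq0 //; lia.
Qed.

Lemma hyper_f1_trunc0 : A1`_0 = 1.
Proof. by rewrite coef_fps_trunc ?prime_gt0 // hyper_f1_coef0. Qed.

Lemma hyper_f2_trunc0 : A2`_0 = 1.
Proof. by rewrite coef_fps_trunc ?prime_gt0 // hyper_f2_coef0. Qed.

(** The monomials in g1, g2 satisfy G = B G^p with B the same monomial in the truncations, so
    [frobenius_relation] yields an identity that [hyper_mup_independent] refutes over an algebraic
    closure. *)
Lemma hyper_relation_mod_p (T : finType) (e1 e2 : T -> nat) d
    (c : {ffun T -> {poly 'F_p}}) (g1 g2 : fps 'F_p) :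
    injective (fun s => (e1 s, e2 s)) ->
    (forall s, e1 s <= d)%N -> (forall s, e2 s <= d)%N ->
    (101 < p)%N -> (3 * d < p.-1)%N -> g1 != 0 -> g2 != 0 ->
    g1 = fps_of_poly A1 * g1 ^+ p -> g2 = fps_of_poly A2 * g2 ^+ p ->
  \sum_s fps_of_poly (c s) * (g1 ^+ e1 s * g2 ^+ e2 s) = 0 -> c = 0.
Proof.
move=> e_inj e1d e2d p101 dp g10 g20 g1E g2E cg; apply: contrapT => /eqP c0.
have [||s [s' [ss' [a [b [a0 b0 abE]]]]]] :=
  @frobenius_relation p p_pr T (fun s => g1 ^+ e1 s * g2 ^+ e2 s)
    (fun s => A1 ^+ e1 s * A2 ^+ e2 s) c _ _ c0 cg.
- move=> s /=; have expE (A : {poly 'F_p}) (g : fps 'F_p) n :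
      g = fps_of_poly A * g ^+ p -> g ^+ n = fps_of_poly (A ^+ n) * (g ^+ n) ^+ p.
    by move=> gE; rewrite rmorphXn /= exprAC -exprMn -gE.
  rewrite {1}(expE _ _ (e1 s) g1E) {1}(expE _ _ (e2 s) g2E) rmorphM /=.
  by rewrite [in RHS]exprMn mulrACA.
- by move=> s; rewrite mulf_neq0 ?expf_neq0.
have [K [phi _]] := countable_algebraic_closure 'F_p.
have pK : p \in [pchar K] by apply: (rmorph_pchar phi); exact: pchar_Fp.
pose P1 := map_poly phi A1; pose P2 := map_poly phi A2.
have := congr1 (map_poly phi) abE.
rewrite !rmorphM !rmorphXn /= => /eqP; apply/negP.
apply: (@hyper_mup_independent K p t pK pE P1 P2 _ _ _ _ _ _ d) => //.
- rewrite size_map_poly; apply: size_trunc; first by lia.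
  exact: hyper_f1_Fp_eq0.
- rewrite size_map_poly; apply: size_trunc; first by lia.
  exact: hyper_f2_Fp_eq0.
- rewrite coef_map hyper_f1_trunc0; exact: rmorph1.
- rewrite coef_map hyper_f2_trunc0; exact: rmorph1.
- move=> n; rewrite !coef_map -[X in X * _](rmorph_nat phi) -rmorphM hyper_f1_rec.
  by rewrite rmorphM rmorph_nat.
- move=> n; rewrite !coef_map -[X in X * _](rmorph_nat phi) -rmorphM hyper_f2_rec.
  by rewrite rmorphM rmorph_nat.
- by apply: contraNneq ss' => ee; apply/eqP/e_inj.
- by rewrite map_poly_eq0.
- by rewrite map_poly_eq0.
Qed.

End Truncation.

(** * Algebraic independence *)

Lemma fps_coef_sum (K : fieldType) (I : Type) (r : seq I) (P : pred I)
    (f : I -> fps K) n :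
  fps_coef (\sum_(i <- r | P i) f i) n = \sum_(i <- r | P i) fps_coef (f i) n.
Proof. exact: (big_morph (fun f => fps_coef f n)). Qed.

Lemma fps_coef_polyM (K : fieldType) (P : {poly K}) (G : fps K) D n :
  (size P <= D)%N ->
  fps_coef (fps_of_poly P * G) n =
    \sum_(k < D) P`_k * fps_coef (fps_of_poly 'X^k * G) n.
Proof.
move=> PD; have {1}-> : P = \sum_(k < D) P`_k *: 'X^k.
  rewrite -[LHS]coefK poly_def (big_ord_widen _ (fun k => P`_k *: 'X^k) PD).
  rewrite big_mkcond; apply: eq_bigr => k _; case: ltnP => // Pk.
  by rewrite nth_default // scale0r.
rewrite raddf_sum mulr_suml fps_coef_sum; apply: eq_bigr => k _.
rewrite !fps_coefM mulr_sumr; apply: eq_bigr => i _ /=.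
by rewrite coefZ mulrA.
Qed.

(** A relation with polynomial coefficients becomes a relation with constant coefficients between
    the series z^k G s. *)
Lemma fps_relation_coef (K : fieldType) (T : finType) (c : T -> {poly K})
    (G : T -> fps K) D n : (forall s, size (c s) <= D)%N ->
  fps_coef (\sum_s fps_of_poly (c s) * G s) n =
    \sum_(u : T * 'I_D) (c u.1)`_u.2 * fps_coef (fps_of_poly 'X^(u.2) * G u.1) n.
Proof.
move=> cD; rewrite fps_coef_sum; under eq_bigr do rewrite (fps_coef_polyM _ _ (cD _)).
by rewrite pair_bigA.
Qed.

(** The coefficients [c] may be transcendental: only the series z^k f1^i f2^j are reduced modulo p,
    and [reduces_dependent] supplies new coefficients over F_p. *)
Lemma hyper_poly_independent (F : numFieldType) (T : finType) (e1 e2 : T -> nat)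
    (c : T -> {poly F}) :
    injective (fun s => (e1 s, e2 s)) ->
    \sum_s fps_of_poly (c s) * (hyper_f1 F ^+ e1 s * hyper_f2 F ^+ e2 s) = 0 ->
  forall s, c s = 0.
Proof.
move=> e_inj cf s0; apply: contrapT => /eqP cs0.
pose d := \max_s maxn (e1 s) (e2 s); pose D := \max_s size (c s).
have ed s : (maxn (e1 s) (e2 s) <= d)%N.
  exact: (leq_bigmax (F := fun s => maxn (e1 s) (e2 s))).
have cD s : (size (c s) <= D)%N by exact: (leq_bigmax (F := fun s => size (c s))).
(* The bound 3 d + 1 < p gives 3 d < p - 1, and 101 < p gives t > 0. *)
have [p p_pr [p_large [t pE]]] := prime_1mod30 (maxn 101 (3 * d).+1).
have t_gt0 : (0 < t)%N by lia.
have [g1 g1r g1L] := hyper_f1_reduction F p_pr pE t_gt0.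
have [g2 g2r g2L] := hyper_f2_reduction F p_pr pE t_gt0.
have rel : exists2 a : T * 'I_D -> F, exists u, a u != 0 & forall n,
    \sum_u a u * fps_coef (fps_of_poly 'X^(u.2) *
      (hyper_f1 F ^+ e1 u.1 * hyper_f2 F ^+ e2 u.1)) n = 0.
  exists (fun u : T * 'I_D => (c u.1)`_(u.2)); last first.
    pose G s := hyper_f1 F ^+ e1 s * hyper_f2 F ^+ e2 s.
    by move=> n; rewrite -(fps_relation_coef G n cD) cf.
  have lt0 : (0 < size (c s0))%N by rewrite size_poly_gt0.
  have ltD : ((size (c s0)).-1 < D)%N by rewrite prednK.
  by exists (s0, Ordinal ltD); rewrite -lead_coefE lead_coef_eq0.
have [b b0 bg] := @reduces_dependent F p (T * 'I_D)%type
  (fun (u : T * 'I_D) n => fps_coef (fps_of_poly 'X^(u.2) *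
    (hyper_f1 F ^+ e1 u.1 * hyper_f2 F ^+ e2 u.1)) n)
  (fun (u : T * 'I_D) n => fps_coef (fps_of_poly 'X^(u.2) *
    (g1 ^+ e1 u.1 * g2 ^+ e2 u.1)) n)
  p_pr
  (fun u => fps_reducesM (@fps_reduces_Xn F p u.2)
    (fps_reducesM (fps_reducesX _ g1r) (fps_reducesX _ g2r)))
  rel.
(* The constants [b (s, k)] are reassembled into polynomials of size at most [D]. *)
pose B := [ffun s => \poly_(k < D) (if insub k is Some k' then b (s, k') else 0)].
have BE s (k : 'I_D) : (B s)`_k = b (s, k) by rewrite ffunE coef_poly ltn_ord valK.
have g10 : g1 != 0.
  apply: contra_neq (oner_neq0 'F_p) => g0.
  apply: reduces_fun (reduces1 F p) _.
  by rewrite -(hyper_f1_coef0 F) -[0]/(fps_coef 0 0) -g0.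
have g20 : g2 != 0.
  apply: contra_neq (oner_neq0 'F_p) => g0.
  apply: reduces_fun (reduces1 F p) _.
  by rewrite -(hyper_f2_coef0 F) -[0]/(fps_coef 0 0) -g0.
have B0 : B = 0.
  apply: (@hyper_relation_mod_p p t p_pr pE t_gt0 T e1 e2 d B g1 g2 e_inj) => //.
  - by move=> s; apply: leq_trans (ed s); exact: leq_maxl.
  - by move=> s; apply: leq_trans (ed s); exact: leq_maxr.
  - by lia.
  - by lia.
  - exact: fps_lucas_eq.
  - exact: fps_lucas_eq.
  apply/fpsP => n; rewrite (@fps_relation_coef _ _ _ _ D).
    by under eq_bigr do rewrite BE -surjective_pairing; exact: bg.
  by move=> s; rewrite ffunE size_poly.
move/eqP: b0; apply; apply/ffunP => -[s k].
by rewrite -BE B0 !ffunE coef0.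
Qed.

Lemma common_denominator (K : fieldType) (I : finType) (x : I -> {fraction {poly K}}) :
  exists2 q : {poly K}, q != 0 &
    forall i, exists a, x i * FracField.tofrac q = FracField.tofrac a.
Proof.
exists (\prod_i \d_(repr (x i))); first by apply/prodf_neq0 => i _; exact: denom_ratioP.
move=> i; exists (\n_(repr (x i)) * \prod_(j | j != i) \d_(repr (x j))).
rewrite (bigD1 i) //= !tofracM mulrA; congr (_ * _).
by rewrite {1}[x i]ratfun_numden divfK // tofrac_eq0 denom_ratioP.
Qed.

Lemma laurent_of_poly (K : fieldType) (a : {poly K}) :
  laurent_of_ratfun (FracField.tofrac a) = FracField.tofrac (fps_of_poly a).
Proof.
rewrite -[X in laurent_of_ratfun X]divr1 -tofrac1 laurent_of_ratfunE ?oner_neq0 //.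
by rewrite /laurent_of_fps !rmorph1 divr1.
Qed.

(** Monomials of degree below [msize P] form a finite type, as [hyper_poly_independent] requires of
    its indices. *)
Lemma meval_map_mpoly2 (K L : fieldType) (f : {rmorphism K -> L}) (v : 'I_2 -> L)
    (P : {mpoly K[2]}) :
  (map_mpoly f P).@[v] =
    \sum_(m : 'X_{1..2 < msize P}) f P@_m * (v ord0 ^+ m ord0 * v ord_max ^+ m ord_max).
Proof.
rewrite /map_mpoly (mmapE (msize P)) // rmorph_sum; apply: eq_bigr => m _ /=.
rewrite mevalM mevalC; congr (_ * _).
rewrite /mmap1 rmorph_prod /= !big_ord_recl big_ord0 /= mulr1.
rewrite !rmorphXn /= !mevalXU.
by rewrite (_ : lift ord0 ord0 = ord_max) //; exact: val_inj.
Qed.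

Theorem theorem9p7 (R : realType) :
  algebraically_independent
    (@laurent_of_ratfun R[i] : {rmorphism {fraction {poly R[i]}} -> laurent R[i]})
    (tnth [tuple laurent_of_fps (hyper_f1 R[i]);
                 laurent_of_fps (hyper_f2 R[i])]).
Proof.
move=> P; rewrite meval_map_mpoly2 => relP.
pose T := 'X_{1..2 < msize P}.
(* Multiplication by a common denominator [q] replaces the coefficients of [P] by polynomials [N m],
   so the relation holds between power series. *)
have [q q0 /choice[N NP]] := common_denominator (fun m : T => P@_m).
have N0 : forall m : T, N m = 0.
  apply: (@hyper_poly_independent R[i] T (fun m => m ord0) (fun m => m ord_max)).
    move=> m m' [m0 m1]; apply/val_inj/mnmP => i.
    case: (unliftP ord0 i) => [j ->|->//].
    by rewrite ord1 [lift _ _](_ : _ = ord_max) //; exact: val_inj.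
  apply/eqP; rewrite -tofrac_eq0 rmorph_sum /=; apply/eqP.
  rewrite -[RHS](mulr0 (FracField.tofrac (fps_of_poly q))) -[X in _ = _ * X]relP.
  rewrite mulr_sumr; apply: eq_bigr => m _.
  rewrite !rmorphM !rmorphXn /= [RHS]mulrA; congr (_ * _).
  by rewrite -!laurent_of_poly -NP rmorphM mulrC.
apply/mpolyP => m; rewrite mcoeff0; have [Pm|Pm] := boolP (m \in msupp P); last first.
  by rewrite memN_msupp_eq0.
have mP : (mdeg m < msize P)%N by exact: msize_mdeg_lt.
have := NP (BMultinom mP); rewrite N0 tofrac0 => /eqP.
by rewrite mulf_eq0 tofrac_eq0 (negPf q0) orbF => /eqP.
Qed.
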